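(* Let $\mathcal{L}_m(t,x)$ ($m\ge 0$, $t\ge 0$, $x\in\mathbb{R}$) be the linearly interpolated, normalized local times of the nested ''twist and shrink'' random walks $\tilde B_m$ described in the context, and let $W=\lim_{m\to\infty}\tilde B_m$ be the resulting Brownian motion. For every $K>0$, the sequence $(\mathcal{L}_m(t,x))_{m}$ converges almost surely, uniformly on the strip $[0,K]\times\mathbb{R}$, as $m\to\infty$. The limit is a process $\mathcal{L}(t,x)$ jointly continuous in $(t,x)$, the local time of the Brownian motion $W(t)$. Moreover, for any $C>1$ there is a constant $N_6(C)$, depending only on $C$, such that for any real $K>0$ and integer $m\ge 1$ with $K2^{2m}\ge N_6(C)$, $$\mathbf{P}\left\{ \sup_{(t,x)\in[0,K]\times\mathbb{R}} |\mathcal{L}(t,x)-\mathcal{L}_m(t,x)| \ge 79\, C\, K_*^{1/4}(\log_*K)^{3/4} m^{3/4} 2^{-m/2}\right\} \le \frac{15}{1-4^{1-C}}\,(K2^{2m})^{1-C}.$$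
   Context: Notation: $\log$ is the natural logarithm, $\log_* x=\max\{1,\log x\}$, $K_*=\max\{1,K\}$, $\mathbf{N}_0=\{0,1,2,\dots\}$. ''Twist and shrink'' construction. Let $X_m(k)$ ($m\ge 0$, $k\ge 1$) be i.i.d. random variables on a probability space $(\Omega,\mathcal{F},\mathbf{P})$ with $\mathbf{P}\{X_m(k)=\pm1\}=1/2$. Put $S_m(0)=0$, $S_m(n)=\sum_{k=1}^n X_m(k)$. For $m\ge 1$ let $T_m(0)=0$ and $T_m(k+1)=\min\{n: n>T_m(k),\ |S_m(n)-S_m(T_m(k))|=2\}$ for $k\ge 0$ (almost surely finite). Let $\tilde X_0(n)=X_0(n)$, $\tilde S_0(n)=S_0(n)$. Recursively, for $m\ge 1$, $\tilde S_m(0)=0$ and, for every $k\ge 0$ and every $n$ with $T_m(k)<n\le T_m(k+1)$, $\tilde X_m(n)=X_m(n)$ if $S_m(T_m(k+1))-S_m(T_m(k))=2\tilde X_{m-1}(k+1)$, and $\tilde X_m(n)=-X_m(n)$ otherwise; $\tilde S_m(n)=\tilde S_m(n-1)+\tilde X_m(n)$. Each $\tilde S_m$ is a simple symmetric random walk, and $\tilde S_{m+1}(T_{m+1}(k))=2\tilde S_m(k)$ for $m,k\ge 0$. Extend $\tilde S_m$ to real $t\ge 0$ by linear interpolation and set $\tilde B_m(t)=2^{-m}\tilde S_m(t2^{2m})$. It is known that almost surely $\tilde B_m$ converges uniformly on bounded intervals to a Brownian motion $W$ (standard Wiener process). Discrete local times. For $x\in\mathbb{Z}$ let $\ell_m(0,x)=0$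 and $\ell_m(k,x)=\#\{j: 0\le j<k,\ \tilde S_m(j)=x\}$ for integers $k\ge 1$. For $t\in 2^{-2m}\mathbf{N}_0$, $x\in 2^{-m}\mathbb{Z}$ let $\mathcal{L}_m(t,x)=2^{-m}\ell_m(t2^{2m},x2^m)$. For arbitrary real $t\ge 0$ and $x\in\mathbb{R}$ it is extended by linear interpolation: with $t_k=k2^{-2m}$, $x_j=j2^{-m}$ and $(t,x)\in[t_k,t_{k+1}]\times[x_j,x_{j+1}]$, $$\mathcal{L}_m(t,x)=\mathcal{L}_m(t_k,x_j)+\tfrac{t-t_k}{t_{k+1}-t_k}\big(\mathcal{L}_m(t_{k+1},x_{j+1})-\mathcal{L}_m(t_k,x_{j+1})\big)+\tfrac{x-x_j}{x_{j+1}-x_j}\big(\mathcal{L}_m(t_k,x_{j+1})-\mathcal{L}_m(t_k,x_j)\big)$$ if $x\ge x_j+2^m(t-t_k)$, and $$\mathcal{L}_m(t,x)=\mathcal{L}_m(t_k,x_j)+\tfrac{t-t_k}{t_{k+1}-t_k}\big(\mathcal{L}_m(t_{k+1},x_j)-\mathcal{L}_m(t_k,x_j)\big)+\tfrac{x-x_j}{x_{j+1}-x_j}\big(\mathcal{L}_m(t_{k+1},x_{j+1})-\mathcal{L}_m(t_{k+1},x_j)\big)$$ if $x<x_j+2^m(t-t_k)$. The local time of the Brownian motion $W$ is here, by definition, the limit of $\mathcal{L}_m(t,x)$ as $m\to\infty$; thus the phrase ''the local time of $W$'' in the claim names the limit. *)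

(* Defs.v *)
From HB Require Import structures.
From mathcomp Require Import all_boot all_order all_algebra finmap.
From mathcomp Require Import all_classical all_reals all_analysis.

Set Implicit Arguments.
Unset Strict Implicit.
Unset Printing Implicit Defensive.

Import Order.TTheory GRing.Theory Num.Theory.
Import numFieldNormedType.Exports.

Local Open Scope classical_set_scope.
Local Open Scope ring_scope.

(* 0 if A is empty *)
Definition least (A : set nat) : nat :=
  xget 0%N [set n | A n /\ forall i, A i -> (n <= i)%N].

(* The construction is pathwise: [x m k] is the value of the k-th step of the
   m-th walk at a fixed sample point, for k >= 1; [x m 0] is never used. *)
Section TwistAndShrink.
Variables (R : realType) (x : nat -> nat -> R).

Definition walk (m n : nat) : R := \sum_(1 <= k < n.+1) x m k.

(* The minimum exists for almost all samples only; elsewhere the value given by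
   [least] is arbitrary. *)
Fixpoint hit (m k : nat) : nat :=
  if k is k'.+1 then
    least [set n | (hit m k' < n)%N /\ `|walk m n - walk m (hit m k')| = 2]
  else 0%N.

(* When all hitting times of walk m exist, each n >= 1 lies in exactly one
   block ]hit m k, hit m k.+1], so that the existential over k only names
   this block. *)
Fixpoint twisted_step (m n : nat) : R :=
  if m is m'.+1 then
    if `[< exists k, (hit m k < n <= hit m k.+1)%N /\
             walk m (hit m k.+1) - walk m (hit m k)
               = 2 * twisted_step m' k.+1 >]
    then x m n else - x m n
  else x 0%N n.

Definition twisted_walk (m n : nat) : R :=
  \sum_(1 <= k < n.+1) twisted_step m k.

Definition interpolate (s : nat -> R) (t : R) : R :=
  let n := Num.truncn t in s n + (t - n%:R) * (s n.+1 - s n).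

Definition shrunk_walk (m : nat) (t : R) : R :=
  2 ^- m * interpolate (twisted_walk m) (t * 2 ^+ (2 * m)).

Definition visits (m k : nat) (z : int) : nat :=
  count (fun j => twisted_walk m j == z%:~R) (iota 0 k).

(* normalized local time at the grid point (k 2^(-2m), z 2^(-m)) *)
Definition grid_local_time (m k : nat) (z : int) : R :=
  2 ^- m * (visits m k z)%:R.

(* The two affine pieces agree on the common boundaries of the triangles of the
   mesh, so the half-open cells selected by [truncn] and [floor] give the same
   function as the closed ones. Meant for p.1 >= 0. *)
Definition walk_local_time (m : nat) (p : R * R) : R :=
  let: (t, y) := p in
  let T i : R := i%:R * 2 ^- (2 * m) in
  let Y i : R := i%:~R * 2 ^- m in
  let k := Num.truncn (t * 2 ^+ (2 * m)) in
  let j := Num.floor (y * 2 ^+ m) in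
  let G := grid_local_time m in
  if Y j + 2 ^+ m * (t - T k) <= y then
    G k j + (t - T k) / (T k.+1 - T k) * (G k.+1 (j + 1) - G k (j + 1))
          + (y - Y j) / (Y (j + 1) - Y j) * (G k (j + 1) - G k j)
  else
    G k j + (t - T k) / (T k.+1 - T k) * (G k.+1 j - G k j)
          + (y - Y j) / (Y (j + 1) - Y j) * (G k.+1 (j + 1) - G k.+1 j).

End TwistAndShrink.

Definition strip (R : realType) (K : R) : set (R * R) := `[0, K] `*` setT.

Definition max1 (R : realType) (a : R) : R := Num.max 1 a.

Section Probability.
Context d (Omega : measurableType d) (R : realType).
Variable P : probability Omega R.

Definition mutually_independent (I : choiceType) (A : set I)
    (Y : I -> {RV P >-> R}) : Prop :=
  forall J : {fset I}, [set` J] `<=` A ->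
  forall B : I -> set R, (forall i, measurable (B i)) ->
    P (\bigcap_(i in [set` J]) (Y i @^-1` B i))
      = (\prod_(i <- J) P (Y i @^-1` B i))%E.

Variable X : nat -> nat -> {RV P >-> R}.

Definition iid_signs : Prop :=
  mutually_independent [set i : nat * nat | (1 <= i.2)%N]
    (fun i => X i.1 i.2) /\
  forall m k, (1 <= k)%N ->
    P (X m k @^-1` [set 1]) = (2^-1)%:E /\
    P (X m k @^-1` [set -1]) = (2^-1)%:E.

Definition sample (w : Omega) : nat -> nat -> R := fun m k => X m k w.

Definition limit_motion (W : Omega -> R -> R) : Prop :=
  {ae P, forall w, forall K : R, 0 < K ->
    {uniform `[0, K], (fun m => shrunk_walk (sample w) m) @ \oo --> W w}}.

(* The local time of the limit motion is by definition the limit of the local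
   times of the approximating walks. *)
Definition local_time_of (W : Omega -> R -> R) (L : Omega -> R * R -> R) :
    Prop :=
  limit_motion W /\
  {ae P, forall w, forall p : R * R, 0 <= p.1 ->
    walk_local_time (sample w) m p @[m --> \oo] --> L w p}.

(* {sup over the strip of |L - L_m| >= r}; the supremum is taken in \bar R, since
   the real [sup] of an unbounded set is 0. *)
Definition deviation_event (L : Omega -> R * R -> R) (m : nat) (K r : R) :
    set Omega :=
  [set w | (r%:E <= ereal_sup
    [set `|L w p - walk_local_time (sample w) m p|%:E | p in strip K])%E].

End Probability.

(* Main.v *)
Require Import Defs.
From HB Require Import structures.
From mathcomp Require Import all_boot all_order all_algebra finmap.
From mathcomp Require Import all_classical all_reals all_analysis.
From mathcomp Require Import zify ring lra.

Set Implicit Arguments.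
Unset Strict Implicit.
Unset Printing Implicit Defensive.

Import Order.TTheory GRing.Theory Num.Theory.
Import numFieldNormedType.Exports.

Local Open Scope classical_set_scope.
Local Open Scope ring_scope.

(* The walks of levels m and m + 1 are compared along a single path. The coarse
   walk is read off the fine one by recording every other point at distance 2,
   and each fine walk is uniformly distributed, because conditionally on its
   untwisted steps the signs by which its blocks are flipped are fair and
   independent. All estimates therefore become estimates on one fair +-1 path.

   Let n = K 4^m and let x be a point of the coarse lattice. Half the number of
   fine visits to 2x before time 4k differs from the number of coarse visits to
   x before time k by three kinds of errors: after each fine visit to 2x the
   block ends with probability 1/2, so the number of ended blocks fluctuates
   around half the number of visits; the number of blocks completed by time 4k
   differs from k by at most about (n log n)^(1/2), which costs the local time of
   a window of that length; and adjacent fine points have nearly equal local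
   times by the discrete Tanaka formula. Each error is controlled by an
   exponential supermartingale built on cosh t <= exp (t^2 / 2), stopped when it
   first becomes large, and is of order n^(1/4) (log n)^(3/4). The resulting
   differences of consecutive normalized local times decrease geometrically, and
   the probabilities of the exceptional events sum to the stated bound. *)

(** * Exponential supermartingales on finite paths *)

Section RealInequalities.
Variable R : realType.
Implicit Types x y : R.

(** The number of blocks completed by fine time [4 k] is a random index into the coarse path.
    Nothing is used about its relation to that path: the coarse local time is controlled in every
    window starting before the horizon, so a union over about [n ^ 2] events replaces conditioning.
    Each exceptional event then concerns a single walk, and the uniform law of that walk suffices;
    no joint law of two levels enters the estimates. This is why they can be made on lists of
    booleans with the counting probability [pr] and be transferred to [P] afterwards.

    Passing to the next level multiplies [n] by 4, hence [n ^ (1/4)] by [sqrt 2], while the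
    normalization is halved. Rounding the ratio up to 3/4 absorbs the growth of the logarithm, and
    the sum of the errors from level [m] on is at most 4 times the error at level [m]. *)

Lemma cosh_le_gauss x : (expR x + expR (- x)) / 2 <= expR (x ^+ 2 / 2).
Proof.
pose u n := series (exp_coeff x) n.*2 + series (exp_coeff (- x)) n.*2.
pose v n := 2 * series (exp_coeff (x ^+ 2 / 2)) n.
have cdbl y : (fun n => series (exp_coeff y) n.*2) @ \oo --> expR y.
  under eq_fun do rewrite -mul2n.
  have H : series (exp_coeff y) @ \oo --> expR y by exact: is_cvg_series_exp_coeff.
 exact: (cvg_comp _ _ (cvg_mulnl 2 isT) H).
have cu : u @ \oo --> expR x + expR (- x) by apply: cvgD; exact: cdbl.
have cv : v @ \oo --> 2 * expR (x ^+ 2 / 2).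
  by apply: cvgM; [exact: cvg_cst|exact: is_cvg_series_exp_coeff].
(* The odd terms cancel, and the even ones compare by [2 ^ n n! <= (2 n)!]. *)
have uv n : u n <= v n.
  rewrite /u /v; elim: n => [|n IH].
    by rewrite /series /= !big_geq// addr0 mulr0.
  rewrite doubleS !seriesSr mulrDr.
  suff : exp_coeff x n.*2 + exp_coeff x n.*2.+1 +
      (exp_coeff (- x) n.*2 + exp_coeff (- x) n.*2.+1)
      <= 2 * exp_coeff (x ^+ 2 / 2) n by move: IH; lra.
  rewrite /exp_coeff /=.
  have -> : (- x) ^+ n.*2 = x ^+ n.*2 by rewrite exprNn -signr_odd odd_double expr0 mul1r.
  have -> : (- x) ^+ n.*2.+1 = - x ^+ n.*2.+1.
    by rewrite exprNn -signr_odd /= odd_double expr1 mulN1r.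
  rewrite mulNr.
  suff : x ^+ n.*2 / n.*2`!%:R <= (x ^+ 2 / 2) ^+ n / n`!%:R by lra.
  rewrite -mul2n exprM expr_div_n -mulrA ler_wpM2l//; first by rewrite -exprM mulnC exprM sqr_ge0.
  rewrite -invfM lef_pV2 ?posrE ?mulr_gt0 ?ltr0n ?fact_gt0 ?exprn_gt0//.
  rewrite -natrX -natrM ler_nat mul2n.
  elim: n {IH} => // n IH; rewrite doubleS 3!factS expnS.
  have : (2 * (n.+1) * (2 ^ n * n`!) <= 2 * n.+1 * (n.*2)`!)%N by rewrite leq_mul2l IH orbT.
  move: (2 ^ n)%N (n`!) (n.*2)`! => a b c; rewrite -mul2n; nia.
have H : expR x + expR (- x) <= 2 * expR (x ^+ 2 / 2).
  by apply: ler_cvg_to cu cv _; exact: nearW.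
by rewrite ler_pdivrMr// mulrC.
Qed.

(** A fair step of size [u] in the exponent is paid for by the drift [- u ^ 2 / 2]. Every
    supermartingale below rests on this. *)
Lemma gauss_step (a u : R) :
  (expR (a + u - u ^+ 2 / 2) + expR (a - u - u ^+ 2 / 2)) / 2 <= expR a.
Proof.
have -> : (expR (a + u - u ^+ 2 / 2) + expR (a - u - u ^+ 2 / 2)) / 2 =
    expR a * ((expR u + expR (- u)) / 2 * expR (- (u ^+ 2 / 2))).
  by rewrite !expRD; field.
rewrite -[leRHS]mulr1 ler_wpM2l ?expR_ge0//.
rewrite (expRN (_ / _)) ler_pdivrMr ?expR_gt0// mul1r.
exact: cosh_le_gauss.
Qed.

(* The minimizer over t of L / t + t V / 2. *)
Definition tilt L V : R := Num.sqrt (2 * L / V).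

Lemma tilt_gt0 L V : 0 < L -> 0 < V -> 0 < tilt L V.
Proof. by move=> L0 V0; rewrite sqrtr_gt0 divr_gt0// mulr_gt0. Qed.

(** At the minimizer both summands are equal. The deviation bounds below have the form
    [L / t + t V / 2] plus a rounding term, so this is the origin of the square roots in
    [step_error]. *)
Lemma tilt_opt L V : 0 < L -> 0 < V ->
  L / tilt L V + tilt L V * V / 2 = Num.sqrt (2 * L * V).
Proof.
move=> L0 V0; have t0 := tilt_gt0 L0 V0.
have t2 : tilt L V ^+ 2 = 2 * L / V by rewrite sqr_sqrtr// divr_ge0 ?mulr_ge0 ?ltW.
have -> : 2 * L * V = (tilt L V * V) ^+ 2.
  by rewrite exprMn t2; field; rewrite gt_eqF.
rewrite sqrtr_sqr ger0_norm ?mulr_ge0 ?ltW//.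
have : L = tilt L V ^+ 2 * V / 2 by rewrite t2; field; rewrite gt_eqF.
by move: (tilt L V) t0 => t t0 ->; field; rewrite gt_eqF.
Qed.

End RealInequalities.

Definition sgb (b : bool) : int := if b then 1 else - 1.
Arguments sgb : simpl never.

(* Paths are lists of up-steps, newest step first. *)
Fixpoint pos (s : seq bool) : int := if s is b :: s' then pos s' + sgb b else 0.

(* Position at the start of the block of the path containing the next step, a
   block being completed when the walk is at distance 2 from its start. *)
Fixpoint anchor (s : seq bool) : int :=
  if s is b :: s' then
    if absz (pos s' + sgb b - anchor s')%R == 2%N then pos s' + sgb b
    else anchor s'
  else 0.

Definition closes (b : bool) (s : seq bool) :=
  absz (pos s + sgb b - anchor s)%R == 2%N.

Fixpoint tally (f : bool -> seq bool -> bool) (s : seq bool) : nat :=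
  if s is b :: s' then (f b s' + tally f s')%N else 0%N.

(** The predicate sees the path before the step, so times strictly smaller than the length are
    counted, as in [visits]. *)
Definition occupation (x : int) := tally (fun _ s => pos s == x).

Definition late_occupation (a : nat) (x : int) :=
  tally (fun _ s => (a <= size s)%N && (pos s == x)).

Definition blocks := tally closes.

Definition blocks_at (A : pred int) := tally (fun b s => closes b s && A (anchor s)).

Definition anchor_visits (A : pred int) :=
  tally (fun _ s => (pos s == anchor s) && A (anchor s)).

(** The suffixes of a list are the earlier stages of the path, the present and the empty path
    included. *)
Fixpoint ever (A : pred (seq bool)) (s : seq bool) : bool :=
  A s || (if s is _ :: s' then ever A s' else false).

Lemma ever_now A s : ~~ ever A s -> ~~ A s.
Proof. by case: s => [|b s] /=; rewrite ?orbF// negb_or => /andP[]. Qed.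

Lemma ever_before A b s : ~~ ever A (b :: s) -> ~~ ever A s.
Proof. by rewrite /= negb_or => /andP[]. Qed.

Lemma anchor_cons b s :
  anchor (b :: s) = if closes b s then pos (b :: s) else anchor s.
Proof. by []. Qed.

Lemma pos_anchor s : (absz (pos s - anchor s)%R <= 1)%N.
Proof.
elim: s => // b s IH; rewrite anchor_cons /closes; case: ifPn => [_|]; first by rewrite subrr.
by move: IH => /=; rewrite /sgb; case: b; lia.
Qed.

Lemma anchor_even s : exists z : int, anchor s = 2 * z.
Proof.
elim: s => [|b s [z IH]]; first by exists 0; rewrite mulr0.
rewrite anchor_cons; case: ifPn => [|_]; last by exists z.
rewrite /closes IH /=; move: (pos s + sgb b) => p h.
have [->|->] : p = 2 * (z + 1) \/ p = 2 * (z - 1) by lia.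
  by exists (z + 1).
by exists (z - 1).
Qed.

Lemma pos_le_size s : (absz (pos s)%R <= size s)%N.
Proof. by elim: s => // b s IH /=; rewrite /sgb; case: b; lia. Qed.

Lemma late_occupation_cons a x b s : late_occupation a x (b :: s) =
  (((a <= size s)%N && (pos s == x)) + late_occupation a x s)%N.
Proof. by []. Qed.

Lemma occupation_cons x b s :
  occupation x (b :: s) = ((pos s == x) + occupation x s)%N.
Proof. by []. Qed.

Lemma blocks_at_cons A b s :
  blocks_at A (b :: s) = ((closes b s && A (anchor s)) + blocks_at A s)%N.
Proof. by []. Qed.

Lemma blocks_cons b s : blocks (b :: s) = (closes b s + blocks s)%N.
Proof. by []. Qed.

Lemma anchor_visits_cons A b s : anchor_visits A (b :: s) =
  (((pos s == anchor s) && A (anchor s)) + anchor_visits A s)%N.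
Proof. by []. Qed.

Lemma late_occupation_before a x s : (size s <= a)%N -> late_occupation a x s = 0%N.
Proof.
elim: s => // b s IH /= h; rewrite late_occupation_cons leqNgt h.
by apply: IH; exact: ltnW.
Qed.

Section Averages.
Variable R : realType.
Implicit Types (F G : seq bool -> R) (s : seq bool).

(* Expectation of F after n further fair steps. *)
Fixpoint avg F n s : R :=
  if n is n'.+1 then (avg F n' (true :: s) + avg F n' (false :: s)) / 2 else F s.

Definition supermartingale F :=
  forall s, (F (true :: s) + F (false :: s)) / 2 <= F s.

Lemma avg_supermartingale F n s : supermartingale F -> avg F n s <= F s.
Proof.
move=> sF; elim: n s => //= n IH s; apply: le_trans (sF s).
by rewrite ler_pM2r ?invr_gt0// lerD.
Qed.

Lemma le_avg F G n s : (forall t, F t <= G t) -> avg F n s <= avg G n s.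
Proof.
move=> FG; elim: n s => //= n IH s; by rewrite ler_pM2r ?invr_gt0// lerD.
Qed.

Lemma avgD F G n s : avg (fun t => F t + G t) n s = avg F n s + avg G n s.
Proof. by elim: n s => //= n IH s; rewrite !IH; field. Qed.

Lemma avgZ c F n s : avg (fun t => c * F t) n s = c * avg F n s.
Proof. by elim: n s => //= n IH s; rewrite !IH; field. Qed.

Definition pr n (A : pred (seq bool)) := avg (fun s => (A s)%:R) n [::].

Lemma pr_has (I : Type) n (A : I -> pred (seq bool)) (r : seq I) c :
  (forall i, pr n (A i) <= c) ->
  pr n (fun s => has (A^~ s) r) <= (size r)%:R * c.
Proof.
move=> Ac; elim: r => [|i r IH] /=.
  rewrite /pr -[fun s => _]/(fun s : seq bool => 0%:R : R) mul0r.
  by elim: n [::] {Ac} => //= n IH s; move: (IH (true :: s)) (IH (false :: s)); lra.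
have -> : (size r).+1%:R * c = c + (size r)%:R * c by rewrite -natr1; ring.
apply: le_trans (lerD (Ac i) IH); rewrite -avgD; apply: le_avg => s.
by case: (A i s); case: has; rewrite /= -?natrD ler_nat.
Qed.

Lemma pr_or n (A B : pred (seq bool)) : pr n (fun s => A s || B s) <= pr n A + pr n B.
Proof.
rewrite -avgD; apply: le_avg => s.
by case: (A s); case: (B s); rewrite /= -?natrD ler_nat.
Qed.

(* Freezing F at the value c when it first exceeds c keeps it a
   supermartingale. *)
Lemma pr_ever F c n : supermartingale F -> (forall s, 0 <= F s) -> 0 < c ->
  pr n (ever (fun s => c <= F s)) <= F [::] / c.
Proof.
move=> sF F0 c0; set E := ever _.
pose G s := if E s then c else F s.
have sG : supermartingale G.
  move=> s; rewrite /G; case Es : (E s); first by rewrite /E /= -/E Es !orbT; lra.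
  apply: le_trans (sF s); rewrite ler_pM2r ?invr_gt0//.
  by apply: lerD; rewrite /E /= -/E Es orbF; case: ifP.
rewrite ler_pdivlMr// mulrC -avgZ.
apply: (@le_trans _ _ (avg G n [::])).
  by apply: le_avg => s; rewrite /G; case: ifP; rewrite ?mulr1 ?mulr0.
apply: le_trans (avg_supermartingale _ _ sG) _.
by rewrite /G /E /= orbF; case: ifP.
Qed.

(** The size [u] of the step may depend on the path; [u = 0] covers the steps at which the exponent
    does not increase. *)
Lemma supermartingale_exp (E : seq bool -> R) :
  (forall s, exists u, E (true :: s) <= E s + u - u ^+ 2 / 2 /\
                       E (false :: s) <= E s - u - u ^+ 2 / 2) ->
  supermartingale (expR \o E).
Proof.
move=> H s; have [u [Ht Hf]] := H s; apply: le_trans (gauss_step (E s) u).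
by rewrite ler_pM2r ?invr_gt0// lerD// ler_expR.
Qed.

(** By the discrete Tanaka formula the occupation of [x] minus the distance to [x] is a martingale
    with steps of size 1 away from [x]: at [x] itself the visit gained is balanced by the forced
    growth of the distance. The exponent is 0 before time [a] and can only drop on reaching it. *)
Definition window_exponent (l : R) a x s : R :=
  if (size s < a)%N then 0 else
  l * (late_occupation a x s)%:R - l * (absz (pos s - x)%R)%:R
  - l ^+ 2 / 2 * (size s - a)%:R.

Lemma window_supermartingale l a x : 0 <= l ->
  supermartingale (expR \o window_exponent l a x).
Proof.
move=> l0; apply: supermartingale_exp => s; rewrite /window_exponent.
have [sa|sa] := ltnP (size s) a.
  exists 0; rewrite expr0n /= mul0r !subr0 addr0.
  have [//|sa'] := ltnP (size s).+1 a.
  rewrite !late_occupation_before//=.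
  have -> : ((size s).+1 - a = 0)%N by lia.
  rewrite !mulr0 !subr0 add0r !oppr_le0.
  by split; rewrite ?sub0r ?oppr_le0 mulr_ge0.
rewrite !late_occupation_cons /= !ltnNge sa (leq_trans sa (leqnSn _)) /=.
have -> : ((size s).+1 - a)%:R = (size s - a)%:R + 1 :> R.
  by rewrite natr1; congr (_%:R); lia.
have l2 : 0 <= l ^+ 2 by apply: sqr_ge0.
have [->|px] := eqVneq (pos s) x.
  exists 0; rewrite -!addrA subrr add0r.
  have -> : (absz (x + (sgb true - x))%R = 1)%N by rewrite /sgb; lia.
  have -> : (absz (x + (sgb false - x))%R = 1)%N by rewrite /sgb; lia.
  by rewrite natrD /=; split; nra.
have [h|h] : (x < pos s) \/ (pos s < x) by lia.
  exists (- l); set d := absz (pos s + sgb false - x)%R.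
  have -> : absz (pos s + sgb true - x)%R = (d + 2)%N by rewrite /d /sgb; lia.
  have -> : absz (pos s - x)%R = (d + 1)%N by rewrite /d /sgb; lia.
  by rewrite add0n !natrD; split; lra.
exists l; set d := absz (pos s + sgb true - x)%R.
have -> : absz (pos s + sgb false - x)%R = (d + 2)%N by rewrite /d /sgb; lia.
have -> : absz (pos s - x)%R = (d + 1)%N by rewrite /d /sgb; lia.
by rewrite add0n !natrD; split; lra.
Qed.

(** The count grows only when the path is at [x], where the distance term vanishes. The exponent at
    the last visit therefore bounds the earlier visits, and the summand 1 is that last visit. *)
Lemma late_occupation_le L l a x w s : 0 <= L -> 0 < l ->
  ~~ ever (fun t => expR L <= (expR \o window_exponent l a x) t) s ->
  (size s <= a + w)%N ->
  (late_occupation a x s)%:R <= L / l + l * w%:R / 2 + 1.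
Proof.
move=> L0 l0; have pos0 : 0 <= L / l + l * w%:R / 2.
  by rewrite addr_ge0 ?divr_ge0 ?mulr_ge0// ltW.
elim: s => [|b s IH] nev sz; first by rewrite addr_ge0.
have nev' := ever_before nev; rewrite late_occupation_cons.
case: (boolP (_ && _)) => [/andP[as_ /eqP px]|_]; last first.
  by rewrite add0n; apply: IH => //; move: sz => /=; lia.
rewrite natrD addrC lerD2r.
have := ever_now nev'; rewrite /= -ltNge ltr_expR /window_exponent ltnNge as_ /= px subrr mulr0 subr0.
have : (size s - a)%:R <= w%:R :> R by rewrite ler_nat; move: sz => /=; lia.
move=> sw h; have -> : L / l + l * w%:R / 2 = (L + l ^+ 2 * w%:R / 2) / l.
  by field; rewrite gt_eqF.
rewrite ler_pdivlMr// mulrC.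
have : l ^+ 2 / 2 * (size s - a)%:R <= l ^+ 2 / 2 * w%:R.
  by rewrite ler_wpM2l// divr_ge0// sqr_ge0.
move: h; lra.
Qed.

Definition above (y z : int) : R := if y < z then 1 else - 1.

Definition gap_exponent (l : R) y s : R :=
  l * ((occupation (y + 1) s)%:R - (occupation y s)%:R + (above y (pos s) - above y 0))
  - l ^+ 2 / 2 * ((occupation y s)%:R + (occupation (y + 1) s)%:R).

(* By the discrete Tanaka formula, occupation (y + 1) - occupation y is, up to
   the bounded term [above], the sum of the steps made from y and y + 1. *)
Lemma gap_supermartingale l y : supermartingale (expR \o gap_exponent l y).
Proof.
apply: supermartingale_exp => s; rewrite /gap_exponent !occupation_cons /=.
rewrite !natrD /above /sgb; set A := (if y < 0 then _ else _).
set c := (occupation y s)%:R; set c1 := (occupation (y + 1) s)%:R.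
have [py|py] := eqVneq (pos s) y.
  exists l; rewrite py.
  have -> : (y == y + 1) = false by lia.
  have -> : y < y + 1 by lia. have -> : y < y = false by lia.
  have -> : y < y - 1 = false by lia.
  by rewrite /= ?mulr1n ?mulr0n; split; lra.
have [py1|py1] := eqVneq (pos s) (y + 1).
  exists l; rewrite py1.
  have -> : y < y + 1 + 1 by lia. have -> : y < y + 1 by lia.
  have -> : y < y + 1 - 1 = false by lia.
  by rewrite /= ?mulr1n ?mulr0n; split; lra.
exists 0.
have -> : (y < pos s + 1) = (y < pos s) by lia.
have -> : (y < pos s - 1) = (y < pos s) by lia.
by rewrite /= expr0n /= !add0r mul0r !subr0 addr0.
Qed.

(** The tilts [l] and [- l] give the two sides of the bound; the summand 2 is the largest change of
    [above]. *)
Lemma occupation_gap_le L l y V s : 0 <= L -> 0 < l ->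
  ~~ ever (fun t => expR L <= (expR \o gap_exponent l y) t) s ->
  ~~ ever (fun t => expR L <= (expR \o gap_exponent (- l) y) t) s ->
  (occupation y s)%:R + (occupation (y + 1) s)%:R <= V ->
  `|(occupation (y + 1) s)%:R - (occupation y s)%:R| <= L / l + l * V / 2 + 2 :> R.
Proof.
move=> L0 l0 /ever_now + /ever_now + hV.
rewrite /= -!ltNge !ltr_expR /gap_exponent sqrrN.
set c := (occupation y s)%:R; set c1 := (occupation (y + 1) s)%:R.
have h z : above y z = 1 \/ above y z = -1 by rewrite /above; case: ifP; [left|right].
have a2 : -2 <= above y (pos s) - above y 0 <= 2.
  by case: (h (pos s)) => ->; case: (h 0) => ->; apply/andP; split; lra.
move: a2; set A := above y (pos s) - above y 0 => /andP[a2 a2'] H1 H2.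
have lV : l ^+ 2 / 2 * (c + c1) <= l ^+ 2 / 2 * V.
  by rewrite ler_wpM2l// divr_ge0// sqr_ge0.
have -> : L / l + l * V / 2 + 2 = (L + l ^+ 2 / 2 * V + 2 * l) / l.
  by field; rewrite gt_eqF.
rewrite ler_pdivlMr// -[X in _ * X](gtr0_norm l0) -normrM ler_norml.
have := ler_wpM2l (ltW l0) a2; have := ler_wpM2l (ltW l0) a2'.
by move=> h1 h2; apply/andP; split; lra.
Qed.

(** Each visit to an anchor is a coin flip with values at distance 1/2 from its mean, whence the
    compensator [(l / 2) ^ 2 / 2]. *)
Definition block_exponent (l : R) A s : R :=
  l * ((blocks_at A s)%:R - (anchor_visits A s)%:R / 2)
  - (anchor_visits A s)%:R * (l ^+ 2 / 8).

(** The flip started at the anchor is decided one step later. While it is pending, the factor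
    [exp l] or 1 that it will contribute is replaced by its expectation. *)
Definition block_weight (l : R) A s : R :=
  expR (block_exponent l A s) *
  (if (pos s != anchor s) && A (anchor s) then (1 + expR l) / 2 else 1).

(* Two steps after a visit to the anchor the block has ended with probability
   1/2, independently of the past. *)
Lemma block_supermartingale l A : supermartingale (block_weight l A).
Proof.
move=> s; rewrite /block_weight /block_exponent !blocks_at_cons !anchor_visits_cons.
rewrite !anchor_cons /closes /=; have := pos_anchor s.
move: (pos s) (anchor s) => p q h; set e := (blocks_at A s)%:R; set v := (anchor_visits A s)%:R.
have [->|pq] := eqVneq p q.
  have -> : (absz (q + sgb true - q)%R == 2)%N = false by rewrite /sgb; lia.
  have -> : (absz (q + sgb false - q)%R == 2)%N = false by rewrite /sgb; lia.
  have -> : q + sgb true != q by rewrite /sgb; lia.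
  have -> : q + sgb false != q by rewrite /sgb; lia.
  rewrite /= !add0n mulr1; case: (A q); last by rewrite !mulr1; lra.
  rewrite natrD -/v -/e.
  apply: le_trans (gauss_step (l * (e - v / 2) - v * (l ^+ 2 / 8)) (l / 2)).
  have h2 (X e' : R) : (X * ((1 + e') / 2) + X * ((1 + e') / 2)) / 2 = (X * e' + X) / 2.
    by field.
  rewrite h2 -expRD ler_pM2r ?invr_gt0//.
  by apply: lerD; rewrite ler_expR /=; lra.
have h1 (X e' : R) : X * ((1 + e') / 2) = (X * e' + X) / 2 by field.
have [->|->] : p = q + 1 \/ p = q - 1 by lia.
  have -> : (absz (q + 1 + sgb true - q)%R == 2)%N by rewrite /sgb; lia.
  have -> : (absz (q + 1 + sgb false - q)%R == 2)%N = false by rewrite /sgb; lia.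
  have -> : q + 1 + sgb false != q = false by rewrite /sgb; lia.
  rewrite eqxx /= !add0n !mulr1; case: (A q) => /=; last by rewrite add0n -/e; lra.
  rewrite natrD -/e h1 -expRD ler_pM2r ?invr_gt0// lerD2r.
  by rewrite ler_expR /=; lra.
have -> : (absz (q - 1 + sgb false - q)%R == 2)%N by rewrite /sgb; lia.
have -> : (absz (q - 1 + sgb true - q)%R == 2)%N = false by rewrite /sgb; lia.
have -> : q - 1 + sgb true != q = false by rewrite /sgb; lia.
rewrite eqxx /= !add0n !mulr1; case: (A q) => /=; last by rewrite add0n -/e; lra.
rewrite natrD -/e h1 -expRD ler_pM2r ?invr_gt0// addrC lerD2r.
by rewrite ler_expR /=; lra.
Qed.

(** The pending factor is at least 1 for the tilt [l] and at least [exp (- l)] for [- l]; discarding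
    it costs the summand 1. *)
Lemma blocks_at_le L l A V s : 0 <= L -> 0 < l ->
  ~~ ever (fun t => expR L <= block_weight l A t) s ->
  ~~ ever (fun t => expR L <= block_weight (- l) A t) s ->
  (anchor_visits A s)%:R <= V ->
  `|(blocks_at A s)%:R - (anchor_visits A s)%:R / 2| <= L / l + l * (V / 4) / 2 + 1 :> R.
Proof.
move=> L0 l0 /ever_now + /ever_now +; rewrite -!ltNge /block_weight => H1 H2 hV.
have {}H1 : expR (block_exponent l A s) < expR L.
  apply: le_lt_trans H1; rewrite -[leLHS]mulr1 ler_wpM2l ?expR_ge0//.
  case: ifP => // _; have := expR_ge1Dx l; lra.
have {}H2 : expR (block_exponent (- l) A s - l) < expR L.
  apply: le_lt_trans H2; rewrite expRD ler_wpM2l ?expR_ge0//.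
  have : expR (- l) <= 1 by rewrite expR_le1 oppr_le0 ltW.
  by case: ifP => // _; lra.
move: H1 H2; rewrite !ltr_expR /block_exponent sqrrN.
set e := (blocks_at A s)%:R; set v := (anchor_visits A s)%:R in hV *.
move=> H1 H2; have lV : l ^+ 2 / 8 * v <= l ^+ 2 / 8 * V.
  by rewrite ler_wpM2l// divr_ge0// sqr_ge0.
have -> : L / l + l * (V / 4) / 2 + 1 = (L + l ^+ 2 / 8 * V + l) / l.
  by field; rewrite gt_eqF.
rewrite ler_pdivlMr// -[X in _ * X](gtr0_norm l0) -normrM ler_norml.
by apply/andP; split; lra.
Qed.

(** The anchor is even and at distance at most 1 from the position, so a path at [2 x] stands on its
    anchor. *)
Lemma anchor_visits_pred1 x s : anchor_visits (pred1 (2 * x)) s = occupation (2 * x) s.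
Proof.
elim: s => // b s IH; rewrite anchor_visits_cons occupation_cons IH; congr (nat_of_bool _ + _)%N.
have [z hz] := anchor_even s; have := pos_anchor s; rewrite hz /=; lia.
Qed.

(** The path is on its anchor exactly at the even times. *)
Lemma anchor_visits_predT s : anchor_visits predT s = uphalf (size s).
Proof.
have par t : odd (size t) = (pos t != anchor t).
  elim: t => // b t IH; rewrite anchor_cons /closes /= IH; have := pos_anchor t.
  by rewrite /sgb; case: b; case: ifP; lia.
elim: s => // b s IH; rewrite anchor_visits_cons IH andbT.
by have /= := par s; case: eqP; rewrite /= ?uphalf_half => _ ->.
Qed.

End Averages.

(** * Comparison of consecutive levels along a path *)

Section Paths.
Implicit Types (e b c f : nat -> bool).

(* Steps are numbered from 1, as in [walk]. *)
Fixpoint hist e n : seq bool := if n is n'.+1 then e n :: hist e n' else [::].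

Lemma size_hist e n : size (hist e n) = n.
Proof. by elim: n => //= n ->. Qed.

Lemma ever_hist A e n i : (i <= n)%N -> ~~ ever A (hist e n) -> ~~ ever A (hist e i).
Proof.
elim: n => [|n IH]; first by rewrite leqn0 => /eqP ->.
rewrite leq_eqVlt => /orP[/eqP -> //|]; rewrite ltnS => ni /ever_before.
exact: IH.
Qed.

Lemma late_occupationE e a x i : (a <= i)%N ->
  occupation x (hist e i) = (late_occupation a x (hist e i) + occupation x (hist e a))%N.
Proof.
elim: i => [|i IH]; first by rewrite leqn0 => /eqP ->.
rewrite leq_eqVlt => /orP[/eqP ->|].
  by rewrite late_occupation_before ?size_hist.
rewrite ltnS => ai; rewrite [hist e i.+1]/= occupation_cons late_occupation_cons.
by rewrite size_hist ai IH// addnA.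
Qed.

Lemma occupation_lipschitz e x i j : (i <= j)%N ->
  (occupation x (hist e i) <= occupation x (hist e j) <= occupation x (hist e i) + (j - i))%N.
Proof.
move=> ij; rewrite -(subnK ij) addnK; elim: (j - i)%N => [|n IH].
  by rewrite add0n leqnn leq_addr.
by rewrite addSn /= occupation_cons; case: (_ == _); lia.
Qed.

Lemma blocks_mono e i j : (i <= j)%N -> (blocks (hist e i) <= blocks (hist e j))%N.
Proof.
move=> ij; rewrite -(subnK ij); elim: (j - i)%N => // n IH.
by rewrite addSn /= blocks_cons; apply: leq_trans IH _; exact: leq_addl.
Qed.

Lemma blocks_le e n : (blocks (hist e n) <= n)%N.
Proof. by elim: n => //= n IH; rewrite blocks_cons; case: closes; lia. Qed.

Lemma anchor_le_size s : (absz (anchor s)%R <= size s)%N.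
Proof.
elim: s => // b s IH; rewrite anchor_cons; case: ifP => _.
  exact: pos_le_size.
by rewrite /= ltnW.
Qed.

(** Together with its two variants below this lets the union bounds run over finitely many lattice
    points, although the strip is unbounded in space. *)
Lemma occupation_outside x s : (size s < absz x)%N -> occupation x s = 0%N.
Proof.
elim: s => // b s IH h; rewrite occupation_cons IH; last exact: ltnW.
by have := pos_le_size s; case: eqP => // ->; move: h => /=; lia.
Qed.

Lemma late_occupation_outside a x s : (size s < absz x)%N -> late_occupation a x s = 0%N.
Proof.
elim: s => // b s IH h; rewrite late_occupation_cons IH; last exact: ltnW.
by have := pos_le_size s; case: eqP => [->|]; rewrite ?andbF//; move: h => /=; lia.
Qed.

Lemma blocks_at_outside x s : (size s < absz x)%N -> blocks_at (pred1 x) s = 0%N.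
Proof.
elim: s => // b s IH h; rewrite blocks_at_cons IH; last exact: ltnW.
have := anchor_le_size s; rewrite /=; case: eqP => [->|]; rewrite ?andbF//.
by move: h => /=; lia.
Qed.

Lemma blocks_at_predT s : blocks_at predT s = blocks s.
Proof. by elim: s => // b s IH; rewrite blocks_at_cons blocks_cons IH andbT. Qed.

(* The sign of the k-th block of b, false if that block never ends. *)
Definition turn b k : bool :=
  `[< exists i, [/\ blocks (hist b i) = k, closes (b i.+1) (hist b i) & b i.+1] >].

(** Closing a block raises the block count for good, so only one step can close the block with a
    given number. *)
Lemma turnE b i : closes (b i.+1) (hist b i) -> turn b (blocks (hist b i)) = b i.+1.
Proof.
move=> cl; apply/asboolP/idP => [[j [jk cj bj]]|bi]; last by exists i.
suff -> : i = j by [].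
have up n : closes (b n.+1) (hist b n) ->
    forall m, (n < m)%N -> (blocks (hist b n) < blocks (hist b m))%N.
  move=> cn m /(blocks_mono b) => h; apply: leq_trans h.
  by rewrite /= blocks_cons cn.
have [ij|ji|//] := ltngtP i j; first by have := up _ cl _ ij; rewrite jk ltnn.
by have := up _ cj _ ji; rewrite jk ltnn.
Qed.

(** The sum modulo 2 with true flips a step. Blocks are numbered from 0 and coarse steps from 1,
    hence [k.+1]. *)
Definition twist b c n : bool :=
  let k := blocks (hist b n.-1) in b n (+) (turn b k (+) c k.+1).

(** Flipping a block reflects it about its anchor, which keeps its end time, and the choice of the
    flip makes it end on the side prescribed by [c]. The three facts need a common induction. *)
Lemma twist_shape b c i : let f := twist b c in let k := blocks (hist b i) in
  [/\ blocks (hist f i) = k,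
      anchor (hist f i) = 2 * pos (hist c k) &
      pos (hist f i) - anchor (hist f i)
        = sgb (~~ (turn b k (+) c k.+1)) * (pos (hist b i) - anchor (hist b i))].
Proof.
move=> f; elim: i => [|i IH]; first by split; rewrite /= ?subrr ?mulr0.
move: IH; cbv zeta; case; set B := hist b i; set F := hist f i => IH1 IH2 IH3.
set k := blocks B in IH1 IH2 IH3.
have HB : hist b i.+1 = b i.+1 :: B by [].
have HF : hist f i.+1 = f i.+1 :: F by [].
rewrite HB HF {HB HF}.
have fE : f i.+1 = b i.+1 (+) (turn b k (+) c k.+1) by [].
have clE : closes (f i.+1) F = closes (b i.+1) B.
  rewrite /closes fE; move: IH3; move: (pos F) (anchor F) (pos B) (anchor B) (pos_anchor B).
  by move=> p q p' q'; rewrite /sgb; case: (b i.+1); case: (_ (+) _); rewrite /=; lia.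
rewrite !blocks_cons clE IH1 -/k !anchor_cons clE.
case: ifP => cl; last first.
  rewrite add0n; split => //=.
  rewrite fE; move: IH3; rewrite /sgb; case: (b i.+1); case: (_ (+) _); rewrite /=; lia.
rewrite add1n !subrr mulr0; split => //.
(* The closing step of a block is its turn, so the two cancel in [twist]. *)
have fc : f i.+1 = c k.+1.
  by rewrite fE /k turnE// addbA addbb.
rewrite fc in clE *; move: clE (pos_anchor F); rewrite cl /closes IH2 /=.
move: (pos F) (pos (hist c k)) => p q; rewrite /sgb; case: (c k.+1); lia.
Qed.

(** This is the exact identity behind the comparison: a completed fine block started at [2 x] is one
    coarse step taken from [x]. *)
Lemma blocks_at_twist b c x i :
  blocks_at (pred1 (2 * x)) (hist (twist b c) i)
  = occupation x (hist c (blocks (hist (twist b c) i))).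
Proof.
elim: i => //= i IH; rewrite blocks_at_cons blocks_cons IH.
have [bE aE _] := twist_shape b c i; case: (closes _ _) => //=.
rewrite occupation_cons aE -bE; congr (nat_of_bool _ + _)%N.
by rewrite (inj_eq (mulfI _)).
Qed.

End Paths.

Definition int_range (n : nat) : seq int := [seq i%:Z - n%:Z | i <- iota 0 (2 * n).+1].

Lemma mem_int_range n z : (z \in int_range n) = (absz z <= n)%N.
Proof.
apply/mapP/idP => [[i]|zn]; first by rewrite mem_iota => /andP[_ h] ->; lia.
by exists (absz (z + n%:Z)%R); rewrite ?mem_iota; lia.
Qed.

Lemma size_int_range n : size (int_range n) = (2 * n).+1.
Proof. by rewrite size_map size_iota. Qed.

(** * One refinement step: exceptional events, error and probabilities *)

Section OneStep.
Variables (R : realType) (L : R) (M : nat).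
Hypotheses (L0 : 0 < L) (M0 : (0 < M)%N).

Definition exceeds (F : seq bool -> R) : pred (seq bool) := ever (fun s => expR L <= F s).

(** Chosen to exceed [sqrt (L M) + 1], the bound of [blocks_le_sqrt] on the fluctuation of the
    number of completed blocks. *)
Definition window : nat := (Num.truncn (Num.sqrt (L * M%:R))).+2.

(** The bound of [late_occupation_le], at the optimal tilt, for a fine path of [4 M] steps. *)
Definition max_occupation : R := Num.sqrt (8 * L * M%:R) + 1.

Definition bad_coarse : pred (seq bool) := fun s =>
  has (fun a => has (fun x => exceeds
    (expR \o window_exponent (tilt L window%:R) a x) s) (int_range (M + window)))
  (iota 0 M.+1).

Definition bad_occupation : pred (seq bool) := fun s =>
  has (fun x => exceeds (expR \o window_exponent (tilt L (4 * M)%:R) 0 x) s)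
    (int_range (4 * M)).

Definition bad_gap (l : R) : pred (seq bool) := fun s =>
  has (fun y => exceeds (expR \o gap_exponent l y) s) (int_range (4 * M).+1).

Definition bad_blocks_at (l : R) : pred (seq bool) := fun s =>
  has (fun x => exceeds (block_weight l (pred1 (2 * x))) s) (int_range (4 * M)).

Definition bad_blocks (l : R) : pred (seq bool) := exceeds (block_weight l predT).

(** Each tilt is matched to a variance: the occupations of two neighbouring points, a quarter of one
    occupation for the flips at one anchor, and a quarter of the [2 M] flips up to time [4 M]. *)
Definition bad_fine : pred (seq bool) := fun s =>
  [|| bad_occupation s,
      bad_gap (tilt L (2 * max_occupation)) s,
      bad_gap (- tilt L (2 * max_occupation)) s,
      bad_blocks_at (tilt L (max_occupation / 4)) s,
      bad_blocks_at (- tilt L (max_occupation / 4)) s,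
      bad_blocks (tilt L (M%:R / 2)) s |
      bad_blocks (- tilt L (M%:R / 2)) s].

(* In this order: coarse window, coin flips at the ends of blocks, spatial gap,
   rounding. *)
Definition step_error : R :=
  Num.sqrt (2 * L * window%:R) + Num.sqrt (L * max_occupation / 2)
  + Num.sqrt (4 * L * max_occupation) + 6.

Let MR0 : 0 < M%:R :> R. Proof. by rewrite ltr0n. Qed.

Let occ0 : 0 < max_occupation.
Proof. by rewrite /max_occupation; have := sqrtr_ge0 (8 * L * M%:R); lra. Qed.

Lemma window_le c k j x : (k <= M)%N -> (k <= j + window)%N -> (j <= k + window)%N ->
  ~~ bad_coarse (hist c (M + window)) ->
  `|(occupation x (hist c k))%:R - (occupation x (hist c j))%:R|
    <= Num.sqrt (2 * L * window%:R) + 1 :> R.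
Proof.
move=> kM kj jk nb.
have key a i : (a <= M)%N -> (a <= i)%N -> (i <= a + window)%N ->
    `|(occupation x (hist c i))%:R - (occupation x (hist c a))%:R|
    <= Num.sqrt (2 * L * window%:R) + 1 :> R.
  move=> aM ai iw; rewrite (late_occupationE c x ai) natrD addrK ger0_norm//.
  have [xl|xl] := ltnP (M + window) (absz x).
    rewrite late_occupation_outside; first by rewrite addr_ge0 ?sqrtr_ge0.
    by rewrite size_hist; lia.
  rewrite -tilt_opt// ?ltr0n//; apply: (late_occupation_le (ltW L0)); rewrite ?size_hist//.
    by rewrite tilt_gt0// ltr0n.
  apply: (@ever_hist _ _ (M + window)%N); first by lia.
  move/hasPn : nb => /(_ a); rewrite mem_iota leq0n add0n ltnS => /(_ aM) /hasPn /(_ x); apply.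
  by rewrite mem_int_range.
(* The window starts at the earlier of the two times, which is at most [M] because [k] is. *)
have [le|le] := leqP k j; last by apply: key => //; lia.
by rewrite distrC; apply: key.
Qed.

Lemma fine_occupation_le s z : (size s <= 4 * M)%N -> ~~ bad_occupation s ->
  (occupation z s)%:R <= max_occupation.
Proof.
move=> sM; have [zl _|zl] := ltnP (4 * M) (absz z).
  by rewrite occupation_outside ?ltW// (leq_ltn_trans sM).
have -> : occupation z s = late_occupation 0 z s by elim: (s) => //= b t ->.
have -> : max_occupation = Num.sqrt (2 * L * (4 * M)%:R) + 1.
  by rewrite /max_occupation natrM; congr (Num.sqrt _ + 1); ring.
move=> /hasPn /(_ z); rewrite mem_int_range => /(_ zl) nb.
rewrite -tilt_opt ?ltr0n ?muln_gt0//; apply: (late_occupation_le (ltW L0)) => //.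
by rewrite tilt_gt0// ltr0n muln_gt0.
Qed.

Lemma fine_gap_le s z : (size s <= 4 * M)%N -> ~~ bad_occupation s ->
  ~~ bad_gap (tilt L (2 * max_occupation)) s ->
  ~~ bad_gap (- tilt L (2 * max_occupation)) s ->
  `|(occupation (z + 1) s)%:R - (occupation z s)%:R|
    <= Num.sqrt (4 * L * max_occupation) + 2.
Proof.
move=> sM; have [zl _ _ _|zl] := ltnP (4 * M).+1 (absz z).
  have [h h'] : (size s < absz z)%N /\ (size s < absz (z + 1)%R)%N by lia.
  by rewrite !occupation_outside// subrr normr0 addr_ge0 ?sqrtr_ge0.
move=> nocc /hasPn /(_ z); rewrite mem_int_range => /(_ zl) nb1.
move=> /hasPn /(_ z); rewrite mem_int_range => /(_ zl) nb2.
rewrite (_ : 4 * L * max_occupation = 2 * L * (2 * max_occupation)); last by ring.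
have V0 : 0 < 2 * max_occupation by rewrite mulr_gt0.
rewrite -tilt_opt//; apply: (occupation_gap_le (ltW L0)); rewrite ?tilt_gt0//.
by rewrite mulr_natl mulr2n; apply: lerD; exact: fine_occupation_le.
Qed.

Lemma fine_blocks_at_le s x : (size s <= 4 * M)%N -> ~~ bad_occupation s ->
  ~~ bad_blocks_at (tilt L (max_occupation / 4)) s ->
  ~~ bad_blocks_at (- tilt L (max_occupation / 4)) s ->
  `|(blocks_at (pred1 (2 * x)) s)%:R - (occupation (2 * x) s)%:R / 2|
    <= Num.sqrt (L * max_occupation / 2) + 1.
Proof.
move=> sM; have [xl _ _ _|xl] := ltnP (4 * M) (absz x).
  have h : (size s < absz (2 * x)%R)%N by lia.
  by rewrite occupation_outside ?blocks_at_outside// mul0r subrr normr0 addr_ge0 ?sqrtr_ge0.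
move=> nocc /hasPn /(_ x); rewrite mem_int_range => /(_ xl) nb1.
move=> /hasPn /(_ x); rewrite mem_int_range => /(_ xl) nb2.
rewrite (_ : L * max_occupation / 2 = 2 * L * (max_occupation / 4)); last by field.
have V0 : 0 < max_occupation / 4 by rewrite divr_gt0.
rewrite -tilt_opt// -anchor_visits_pred1; apply: (blocks_at_le (ltW L0)); rewrite ?tilt_gt0//.
by rewrite anchor_visits_pred1; exact: fine_occupation_le.
Qed.

Lemma blocks_le_sqrt f k : (k <= M)%N ->
  ~~ bad_blocks (tilt L (M%:R / 2)) (hist f (4 * k)) ->
  ~~ bad_blocks (- tilt L (M%:R / 2)) (hist f (4 * k)) ->
  `|(blocks (hist f (4 * k)))%:R - k%:R| <= Num.sqrt (L * M%:R) + 1 :> R.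
Proof.
move=> kM; have vE : anchor_visits predT (hist f (4 * k)) = (2 * k)%N.
  by rewrite anchor_visits_predT size_hist; lia.
have -> : k%:R = (anchor_visits predT (hist f (4 * k)))%:R / 2 :> R.
  by rewrite vE natrM mulrAC divff// mul1r.
move=> nb1 nb2; rewrite -blocks_at_predT.
rewrite (_ : L * M%:R = 2 * L * (2 * M%:R / 4)); last by field.
have V0 : 0 < 2 * M%:R / 4 :> R by rewrite divr_gt0// mulr_gt0.
have V2 : 2 * M%:R / 4 = M%:R / 2 :> R by field.
rewrite -tilt_opt//; apply: (blocks_at_le (ltW L0)); rewrite ?V2 ?tilt_gt0 ?divr_gt0//.
by rewrite vE -natrM ler_nat leq_mul2l.
Qed.

(** The slack of 4 in time and 2 in space admits any corner of a fine cell against any corner of the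
    coarse cell containing it. *)
Lemma one_step b c k i x y : let f := twist b c in
  (k <= M)%N -> (i <= 4 * M)%N -> (i <= 4 * k + 4)%N -> (4 * k <= i + 4)%N ->
  (absz (y - 2 * x)%R <= 2)%N ->
  ~~ bad_coarse (hist c (M + window)) -> ~~ bad_fine (hist f (4 * M)) ->
  `|(occupation y (hist f i))%:R / 2 - (occupation x (hist c k))%:R| <= step_error.
Proof.
move=> f kM iM ik ki yx nbc; set s := hist f (4 * k).
have k4 : (4 * k <= 4 * M)%N by rewrite leq_mul2l.
have sM : (size s <= 4 * M)%N by rewrite size_hist.
have early A : ~~ ever A (hist f (4 * M)) -> ~~ ever A s by exact: ever_hist.
have early_has (T : eqType) (r : seq T) (F : T -> seq bool -> R) :
    ~~ has (fun z => exceeds (F z) (hist f (4 * M))) r -> ~~ has (fun z => exceeds (F z) s) r.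
  by move=> /hasPn h; apply/hasPn => z zr; apply: early; exact: h.
rewrite /bad_fine 6!negb_or.
case/and5P => /early_has nocc /early_has ngap /early_has ngap' /early_has nat_.
case/and3P => /early_has nat' /early nbl /early nbl'.
have gap z := fine_gap_le z sM nocc ngap ngap'.
have ends := fine_blocks_at_le x sM nocc nat_ nat'.
have jk := blocks_le_sqrt kM nbl nbl'.
(* From here on [j] is the number of coarse steps completed by fine time [4 k]. *)
move: ends jk; rewrite -/s blocks_at_twist -/f -/s; set j := blocks s => ends jk.
have wn : Num.sqrt (L * M%:R) + 1 < window%:R.
  rewrite /window -[(Num.truncn _).+2]addn2 natrD.
  by have := truncnS_gt (Num.sqrt (L * M%:R)); rewrite -natr1; lra.
have jkw : (k <= j + window)%N /\ (j <= k + window)%N.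
  rewrite -!(ler_nat R) !natrD; move: jk; rewrite ler_norml => /andP[]; lra.
have := window_le x kM jkw.1 jkw.2 nbc.
clear nbc nocc ngap ngap' nat_ nat' nbl nbl' early early_has.
have g2 : `|(occupation y s)%:R - (occupation (2 * x) s)%:R|
    <= 2 * (Num.sqrt (4 * L * max_occupation) + 2).
  set g := Num.sqrt (4 * L * max_occupation) in gap *; have g0 : 0 <= g by apply: sqrtr_ge0.
  have [->|[->|[->|[->|->]]]] : y = 2 * x \/ y = 2 * x + 1 \/ y = 2 * x + 1 + 1 \/
      y = 2 * x - 1 \/ y = 2 * x - 1 - 1 by clear - yx; lia.
  - by rewrite subrr normr0; lra.
  - by have := gap (2 * x); lra.
  - have := gap (2 * x); have := gap (2 * x + 1); rewrite !ler_norml => /andP[? ?] /andP[? ?].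
    by apply/andP; split; lra.
  - by have := gap (2 * x - 1); rewrite subrK distrC; lra.
  - have := gap (2 * x - 1); have := gap (2 * x - 1 - 1); rewrite !subrK !ler_norml => /andP[? ?] /andP[? ?].
    by apply/andP; split; lra.
have t4 : `|(occupation y (hist f i))%:R - (occupation y s)%:R| <= 4 :> R.
  have [le|le] := leqP i (4 * k).
    have /andP[h1 h2] := occupation_lipschitz f y le; rewrite -/s in h1 h2; rewrite distrC -natrB//.
    by rewrite normr_nat ler_nat; clear - h1 h2 ki; lia.
  have /andP[h1 h2] := occupation_lipschitz f y (ltnW le); rewrite -/s in h1 h2; rewrite -natrB//.
  by rewrite normr_nat ler_nat; clear - h1 h2 ik; lia.
(* The constant 6 in [step_error] is half of the time slack 4, the 2 from two spatial gaps after
   halving, and 1 each from the coin flips and the coarse window. *)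
move: t4 g2 ends; rewrite /step_error !ler_norml => /andP[? ?] /andP[? ?] /andP[? ?] /andP[? ?].
by apply/andP; split; lra.
Qed.

Lemma pr_exceeds n F : supermartingale F -> (forall s, 0 <= F s) -> F [::] <= 1 ->
  pr R n (exceeds F) <= expR (- L).
Proof.
move=> sF F0 F1; apply: le_trans (pr_ever n sF F0 (expR_gt0 L)) _.
by rewrite expRN ler_pdivrMr ?expR_gt0// mulVf ?gt_eqF ?expR_gt0.
Qed.

Lemma pr_window n a x l : 0 <= l ->
  pr R n (exceeds (expR \o window_exponent l a x)) <= expR (- L).
Proof.
move=> l0; apply: pr_exceeds; first exact: window_supermartingale.
  by move=> s; exact: expR_ge0.
rewrite /= expR_le1 /window_exponent; case: ifP => // _.
by rewrite mulr0 sub0r mulr0 subr0 oppr_le0 mulr_ge0.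
Qed.

Lemma pr_gap n y l : pr R n (exceeds (expR \o gap_exponent l y)) <= expR (- L).
Proof.
apply: pr_exceeds; first exact: gap_supermartingale.
  by move=> s; exact: expR_ge0.
by rewrite /= expR_le1 /gap_exponent /= !subrr !addr0 !mulr0 subr0.
Qed.

Lemma pr_block n A l : pr R n (exceeds (block_weight l A)) <= expR (- L).
Proof.
apply: pr_exceeds; first exact: block_supermartingale.
  by move=> s; rewrite /block_weight mulr_ge0 ?expR_ge0//; case: ifP => // _.
rewrite /block_weight /= mulr1 expR_le1 /block_exponent /=.
by rewrite !mul0r !subr0 mulr0.
Qed.

Lemma pr_bad_coarse n :
  pr R n bad_coarse <= (M.+1 * (2 * (M + window)).+1)%:R * expR (- L).
Proof.
apply: le_trans (pr_has (c := (2 * (M + window)).+1%:R * expR (- L)) _ _) _.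
  move=> a; apply: le_trans (pr_has _ (fun x => pr_window n a x (sqrtr_ge0 _))) _.
  by rewrite size_int_range.
by rewrite size_iota mulrA -natrM.
Qed.

Lemma pr_bad_fine n : pr R n bad_fine <= (40 * M + 11)%:R * expR (- L).
Proof.
have gap l : pr R n (bad_gap l) <= (8 * M + 3)%:R * expR (- L).
  apply: le_trans (pr_has _ (fun y => pr_gap n y l)) _.
  by rewrite size_int_range ler_wpM2r ?expR_ge0// ler_nat; lia.
have at_ l : pr R n (bad_blocks_at l) <= (8 * M + 1)%:R * expR (- L).
  apply: le_trans (pr_has _ (fun x => pr_block n (pred1 (2 * x)) l)) _.
  by rewrite size_int_range ler_wpM2r ?expR_ge0// ler_nat; lia.
have bl l : pr R n (bad_blocks l) <= expR (- L) by exact: pr_block.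
have oc : pr R n bad_occupation <= (8 * M + 1)%:R * expR (- L).
  apply: le_trans (pr_has _ (fun x => pr_window n 0 x (sqrtr_ge0 _))) _.
  by rewrite size_int_range ler_wpM2r ?expR_ge0// ler_nat; lia.
(* Three families of [8 M + 1] events, two of [8 M + 3] and two single events. *)
have -> : (40 * M + 11)%:R * expR (- L) =
    (8 * M + 1)%:R * expR (- L) + ((8 * M + 3)%:R * expR (- L) +
    ((8 * M + 3)%:R * expR (- L) + ((8 * M + 1)%:R * expR (- L) +
    ((8 * M + 1)%:R * expR (- L) + (expR (- L) + expR (- L)))))).
  by rewrite (natrD _ (40 * M)) !(natrD _ (8 * M)) !natrM; ring.
have or A B a b : pr R n A <= a -> pr R n B <= b -> pr R n (fun s => A s || B s) <= a + b.
  by move=> Aa Bb; apply: le_trans (lerD Aa Bb); exact: pr_or.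
exact: (or _ _ _ _ oc (or _ _ _ _ (gap _) (or _ _ _ _ (gap _) (or _ _ _ _ (at_ _)
  (or _ _ _ _ (at_ _) (or _ _ _ _ (bl _) (bl _))))))).
Qed.

End OneStep.

(** * Numerical estimates *)

Section Numerics.
Variable R : realType.
Implicit Types C K n L : R.

(* The factor 5 / 2 makes exp (- log_bound C n) at most n^(- C - 3 / 2), which
   absorbs a union over about n^2 events. *)
Definition log_bound C n : R := 5 / 2 * C * ln n.

(** One more than the integer part, so that the upper corners of the cells meeting the strip stay
    within the horizon. *)
Definition horizon n : nat := (Num.truncn n).+1.

(** This is [n ^ (1/4) L ^ (3/4)] with [L = log_bound C n]. *)
Definition root_bound C n : R :=
  Num.sqrt (log_bound C n * Num.sqrt (n * log_bound C n)).

(** The exponential gives [ln n >= 80], the largest demand on it coming from [ln_level_le]; the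
    square gives [5 C <= sqrt n], hence [log_bound C n <= n]. *)
Definition threshold C : R := expR 80 + 25 * C ^+ 2.

(** What matters is to stay below 3/2, the factor in [ln_level_le]. The eighth power of [1 + 37/400]
    already exceeds 2. *)
Lemma ln4_le : ln 4 <= 37 / 25 :> R.
Proof.
have -> : (4 : R) = 2 * 2 by ring.
rewrite lnM ?posrE//; suff : ln 2 <= 37 / 50 :> R by lra.
rewrite -[leRHS]expRK ler_ln ?posrE ?expR_gt0//.
have -> : 37 / 50 = 8%:R * (37 / 400) :> R by field.
rewrite expRM_natl.
have : 437 / 400 <= expR (37 / 400) :> R by apply: le_trans (expR_ge1Dx _); lra.
move: (expR _) => e h.
have h2 : 1193 / 1000 <= e ^+ 2 by rewrite expr2; nra.
have h4 : 1423 / 1000 <= e ^+ 4 by rewrite (exprM e 2 2) [leRHS]expr2; nra.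
by rewrite (exprM e 4 2) [leRHS]expr2; nra.
Qed.

Lemma sqrt_le (a b : R) : 0 <= b -> a <= b ^+ 2 -> Num.sqrt a <= b.
Proof. by move=> b0 ab; rewrite -(ger0_norm b0) -sqrtr_sqr ler_wsqrtr. Qed.

Lemma le_sqrt_of_sqr (a b : R) : b ^+ 2 <= a -> b <= Num.sqrt a.
Proof. by move=> ba; apply: le_trans (ler_norm b) _; rewrite -sqrtr_sqr ler_wsqrtr. Qed.

Section Fixed.
Variables C n : R.
Hypotheses (C1 : 1 < C) (nC : threshold C <= n).

Let L := log_bound C n.
Let M := horizon n.

Lemma threshold_ln : 80 <= ln n.
Proof.
rewrite -[leLHS]expRK ler_ln ?posrE ?expR_gt0//.
  by apply: le_trans nC; rewrite /threshold lerDl mulr_ge0 ?sqr_ge0.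
apply: lt_le_trans nC; rewrite ltr_wpDr ?expR_gt0// mulr_ge0 ?sqr_ge0//.
Qed.

Lemma threshold_ge : 1296 <= n.
Proof.
apply: le_trans nC; apply: (@le_trans _ _ (expR 80)); last first.
  by rewrite /threshold lerDl mulr_ge0 ?sqr_ge0.
have -> : 80 = 4%:R * 20 :> R by ring.
rewrite expRM_natl; have : 6 <= expR 20 :> R by apply: le_trans (expR_ge1Dx _); lra.
move: (expR _) => e h.
have h2 : 36 <= e ^+ 2 by rewrite expr2; nra.
by rewrite (exprM e 2 2) [leRHS]expr2; nra.
Qed.

Lemma horizon_bounds : n <= M%:R <= n + 1.
Proof.
have n0 : 0 <= n by have := threshold_ge; lra.
rewrite /M /horizon; have := truncnS_gt n; have := truncn_le n; rewrite n0.
by rewrite -natr1; move=> h1 h2; apply/andP; split; lra.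
Qed.

Lemma log_bound_ge : 50 <= L.
Proof.
rewrite /L /log_bound -mulrA; have A20 := threshold_ln.
have : ln n <= C * ln n by rewrite ler_peMl ?ltW//; lra.
lra.
Qed.

Lemma log_bound_le : L <= n.
Proof.
have n0 : 0 < n by have := threshold_ge; lra.
have C0 : 0 < C by apply: lt_trans C1.
set q := Num.sqrt n; have q0 : 0 < q by rewrite sqrtr_gt0.
have qn : n = q * q by rewrite -expr2 sqr_sqrtr// ltW.
have q5 : 5 * C <= q.
  apply: le_sqrt_of_sqr; apply: le_trans nC.
  by rewrite /threshold exprMn -natrX; have := expR_gt0 (80 : R); lra.
have ln2 : ln n <= 2 * q.
  have h : -1 < q - 1 by lra.
  have := le_ln1Dx h; rewrite (_ : 1 + (q - 1) = q); last by ring.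
  by rewrite qn lnM ?posrE//; lra.
rewrite /L /log_bound; have : C * ln n <= C * (2 * q) by rewrite ler_wpM2l// ltW.
by rewrite [in X in _ -> _ <= X]qn; nra.
Qed.

Lemma step_error_le : step_error L M <= 13 / 2 * root_bound C n.
Proof.
have L50 := log_bound_ge; have n0 := threshold_ge; have /andP[M1 M2] := horizon_bounds.
rewrite /root_bound -/L; set W := Num.sqrt (n * L); set D := Num.sqrt (L * W).
have W0 : 0 <= W by apply: sqrtr_ge0.
have D0 : 0 <= D by apply: sqrtr_ge0.
have WE : W ^+ 2 = n * L by rewrite sqr_sqrtr// mulr_ge0//; lra.
have DE : D ^+ 2 = L * W by rewrite sqr_sqrtr// mulr_ge0//; lra.
have W50 : 50 <= W.
  by rewrite leNgt; apply/negP => h; move: WE; rewrite expr2 => WE; nra.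
have D50 : 50 <= D.
  by rewrite leNgt; apply/negP => h; move: DE; rewrite expr2 => DE; nra.
have wW : (window L M)%:R <= 11 / 10 * W.
  rewrite /window -[(Num.truncn _).+2]addn2 natrD.
  have h : Num.sqrt (L * M%:R) <= 101 / 100 * W.
    apply: sqrt_le; first by lra.
    rewrite exprMn WE expr2; have : L * M%:R <= L * (n + 1) by rewrite ler_wpM2l//; lra.
    by nra.
  have := truncn_le (Num.sqrt (L * M%:R)); rewrite sqrtr_ge0; lra.
have OW : max_occupation L M <= 59 / 20 * W.
  rewrite /max_occupation.
  have h : Num.sqrt (8 * L * M%:R) <= 57 / 20 * W.
    apply: sqrt_le; first by lra.
    rewrite exprMn WE expr2; have : L * M%:R <= L * (n + 1) by rewrite ler_wpM2l//; lra.
    by nra.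
  lra.
have h1 : Num.sqrt (2 * L * (window L M)%:R) <= 149 / 100 * D.
  apply: sqrt_le; first by lra.
  rewrite exprMn DE expr2; have : L * (window L M)%:R <= L * (11 / 10 * W) by rewrite ler_wpM2l//; lra.
  by nra.
have LO : L * max_occupation L M <= L * (59 / 20 * W) by rewrite ler_wpM2l//; lra.
have h2 : Num.sqrt (L * max_occupation L M / 2) <= 122 / 100 * D.
  by apply: sqrt_le; [lra|rewrite exprMn DE expr2; nra].
have h3 : Num.sqrt (4 * L * max_occupation L M) <= 344 / 100 * D.
  by apply: sqrt_le; [lra|rewrite exprMn DE expr2; nra].
(* The three roots add up to [615/100 D], and the 6 is at most [12/100 D] because [D >= 50]. *)
rewrite /step_error; lra.
Qed.

(** The left side is the union bound for one level: at most [5 n ^ 2] events, each of probability at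
    most [exp (- L)]. The factor 5 is absorbed through [5 <= exp 10] and the size of [ln n]. *)
Lemma bad_mass :
  (M.+1 * (2 * (M + window L M)).+1 + (40 * M + 11))%:R * expR (- L)
  <= n `^ (1 - C).
Proof.
have L50 := log_bound_ge; have n0 := threshold_ge; have /andP[M1 M2] := horizon_bounds.
have Ln := log_bound_le; have A20 := threshold_ln.
have wM : (window L M)%:R <= M%:R + 2 :> R.
  rewrite /window -[(Num.truncn _).+2]addn2 natrD lerD2r.
  apply: (@le_trans _ _ (Num.sqrt (L * M%:R))).
    by have := truncn_le (Num.sqrt (L * M%:R)); rewrite sqrtr_ge0.
  by apply: sqrt_le => //; rewrite expr2 ler_wpM2r//; lra.
have h : (M.+1 * (2 * (M + window L M)).+1 + (40 * M + 11))%:R <= 5 * n ^+ 2.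
  rewrite natrD natrM -[M.+1%:R]natr1 -[(2 * _).+1%:R]natr1 (natrM _ 2) (natrD _ M) (natrD _ (40 * M)) (natrM _ 40).
  by rewrite expr2; move: (window L M)%:R (M%:R) wM M1 M2 => w x wM M1 M2; nra.
apply: (@le_trans _ _ (5 * n ^+ 2 * expR (- L))).
  by rewrite ler_wpM2r ?expR_ge0.
have npos : 0 < n by lra.
rewrite /powR gt_eqF// -[n in n ^+ 2]lnK ?posrE// -expRM_natl.
have h5 : 5 <= expR 10 :> R by apply: le_trans (expR_ge1Dx _); lra.
apply: (@le_trans _ _ (expR 10 * expR (2%:R * ln n) * expR (- L))).
  by rewrite ler_wpM2r ?expR_ge0// ler_wpM2r ?expR_ge0.
rewrite -!expRD ler_expR /L /log_bound.
have : ln n <= C * ln n by rewrite ler_peMl ?ltW//; lra.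
lra.
Qed.

Lemma root_bound_gt0 : 0 < root_bound C n.
Proof.
have L50 := log_bound_ge; have n0 := threshold_ge.
have [n1 L1] : 0 < n /\ 0 < L by split; lra.
by rewrite /root_bound -/L sqrtr_gt0 mulr_gt0// sqrtr_gt0 mulr_gt0.
Qed.

(** The logarithm grows by a factor at most 1.074 and the inner root by at most 2.075; their product
    is below [(3/2) ^ 2]. *)
Lemma root_bound_4n : root_bound C (4 * n) <= 3 / 2 * root_bound C n.
Proof.
have L50 := log_bound_ge; have n0 := threshold_ge; have A20 := threshold_ln.
have n1 : 0 < n by lra. have C0 : 0 < C by apply: lt_trans C1.
have L' : log_bound C (4 * n) <= 1074 / 1000 * L.
  rewrite /log_bound lnM ?posrE// /L /log_bound; have := ln4_le.
  by nra.
have L'0 : 0 <= log_bound C (4 * n).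
  by rewrite /log_bound lnM ?posrE// !mulr_ge0 ?addr_ge0 ?ln_ge0//; lra.
have D0 := root_bound_gt0.
apply: sqrt_le; first by lra.
have W0 : 0 <= Num.sqrt (n * L) by apply: sqrtr_ge0.
rewrite exprMn [in leRHS]/root_bound -/L sqr_sqrtr; last by rewrite mulr_ge0//; lra.
have WE : Num.sqrt (n * L) ^+ 2 = n * L by rewrite sqr_sqrtr// mulr_ge0//; lra.
have h : Num.sqrt (4 * n * log_bound C (4 * n)) <= 2075 / 1000 * Num.sqrt (n * L).
  apply: sqrt_le; first by lra.
  rewrite exprMn WE expr2.
  have : n * log_bound C (4 * n) <= n * (1074 / 1000 * L) by rewrite ler_wpM2l//; lra.
  have : 0 <= n * L by rewrite mulr_ge0//; lra.
  lra.
apply: le_trans (ler_pM _ _ L' h) _; rewrite ?sqrtr_ge0//.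
have : 0 <= L * Num.sqrt (n * L) by rewrite mulr_ge0//; lra.
rewrite expr2 -/L; lra.
Qed.

End Fixed.

Lemma pow2_double m : 2 ^+ (2 * m) = 4 ^+ m :> R.
Proof. by rewrite exprM; have -> : 2 ^+ 2 = 4 :> R by ring. Qed.

Lemma max1_ge (x : R) : 1 <= max1 x /\ x <= max1 x.
Proof. by rewrite /max1 !le_max !lexx orbT. Qed.

(** A sum [ln K + m ln 4] is to be bounded by a product. Since [ln 4] is only slightly below 3/2,
    room comes either from [max1 (ln K) >= 3] or from [m >= 50], which the lower bound 80 forces
    otherwise. *)
Lemma ln_level_le K m : 0 < K -> (1 <= m)%N -> 80 <= ln (K * 2 ^+ (2 * m)) ->
  ln (K * 2 ^+ (2 * m)) <= 3 / 2 * (m%:R * max1 (ln K)).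
Proof.
move=> K0 m1; rewrite pow2_double.
rewrite lnM ?posrE ?exprn_gt0// lnXn// -mulr_natl; set a := max1 (ln K).
have [a1 a2] : 1 <= a /\ ln K <= a by exact: max1_ge.
have mR1 : 1 <= m%:R :> R by rewrite ler1n.
have l4 := ln4_le; have ml : m%:R * ln 4 <= m%:R * (37 / 25) :> R by rewrite ler_wpM2l.
move=> h; have ha : 80 <= a + m%:R * (37 / 25) by lra.
suff : a + m%:R * (37 / 25) <= 3 / 2 * (m%:R * a) by lra.
have [am|am] := lerP 3 a; first by nra.
have m12 : 50 <= m%:R :> R by move: ha; lra.
have : 0 <= (a - 1) * (3 / 2 * m%:R - 1) by rewrite mulr_ge0//; lra.
lra.
Qed.

Definition level_error C K m : R :=
  13 / 2 * 2 ^- m * root_bound C (K * 2 ^+ (2 * m)).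

Lemma level_error_half C K m : 1 < C -> threshold C <= K * 2 ^+ (2 * m) ->
  level_error C K m.+1 <= 3 / 4 * level_error C K m.
Proof.
move=> C1 h; rewrite /level_error.
have -> : K * 2 ^+ (2 * m.+1) = 4 * (K * 2 ^+ (2 * m)).
  by rewrite mulnS exprD; move: (2 ^+ (2 * m)) => y; ring.
have := root_bound_4n C1 h; have p0 : 0 < 2 ^- m :> R by rewrite invr_gt0 exprn_gt0.
rewrite exprSr invfM; move: (root_bound _ _) (root_bound _ _) (2 ^- m) p0 => y x p p0 xy.
have : p * x <= p * (3 / 2 * y) by rewrite ler_wpM2l// ltW.
lra.
Qed.

(** The number 15/4 is the product of the 5/2 in [log_bound] and the 3/2 in [ln_level_le]; its power
    3/4 is replaced by 11/4. *)
Lemma numeric_bound : (15 / 4) ^+ 3 <= (11 / 4) ^+ 4 :> R.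
Proof.
have h : 15 / 2 <= (11 / 4) ^+ 2 :> R by rewrite expr2; lra.
rewrite (exprM _ 2 2); move: ((11 / 4) ^+ 2) h => x h.
have : 225 / 4 <= x ^+ 2 by rewrite expr2; nra.
by apply: le_trans; rewrite !exprS expr0; lra.
Qed.

(** Fourth powers are compared, which removes the fractional exponents. The power 3/4 of [C] is at
    most [C], and the constant obtained is [4 * 13/2 * 11/4 = 143/2], below 79. *)
Lemma total_error_lt C K m : 1 < C -> 0 < K -> (1 <= m)%N ->
  threshold C <= K * 2 ^+ (2 * m) ->
  4 * level_error C K m < 79 * C * max1 K `^ 4^-1 * max1 (ln K) `^ (3 / 4)
             * m%:R `^ (3 / 4) * 2 `^ (- (m%:R / 2)).
Proof.
move=> C1 K0 m1 h; rewrite /level_error.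
have C0 : 0 < C by apply: lt_trans C1.
have A := threshold_ln h; have n0 := threshold_ge h; have D0 := root_bound_gt0 C1 h.
have L50 := log_bound_ge C1 h.
have lnle := ln_level_le K0 m1 A.
move: (erefl (root_bound C (K * 2 ^+ (2 * m)))) L50; rewrite {1}/root_bound.
have LE : log_bound C (K * 2 ^+ (2 * m)) <= 15 / 4 * C * (m%:R * max1 (ln K)).
  rewrite /log_bound; have := ler_wpM2l (ltW C0) lnle; lra.
move: (log_bound _ _) LE => L LE DE L50.
set D := root_bound _ _ in D0 DE *; set a := max1 (ln K) in LE *.
have [a1 _] := max1_ge (ln K); have [k1 kK] := max1_ge K; rewrite -/a in a1.
have mR1 : 1 <= m%:R :> R by rewrite ler1n.
have n1 : 0 < K * 2 ^+ (2 * m) by lra.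
have D4 : D ^+ 4 = K * 2 ^+ (2 * m) * L ^+ 3.
  rewrite -DE (exprM _ 2 2) sqr_sqrtr; last by rewrite mulr_ge0 ?sqrtr_ge0//; lra.
  by rewrite exprMn sqr_sqrtr ?mulr_ge0 ?ltW//; [ring|lra].
have pw (x : R) : 0 < x -> (x `^ (3 / 4)) ^+ 4 = x ^+ 3.
  by move=> x0; rewrite -powR_mulrn ?powR_ge0// -powRrM (_ : 3 / 4 * 4%:R = 3%:R) ?powR_mulrn ?ltW//; field.
have pw1 (x : R) : 0 < x -> (x `^ 4^-1) ^+ 4 = x.
  by move=> x0; rewrite -powR_mulrn ?powR_ge0// -powRrM mulVf// powRr1// ltW.
have p2 : (2 `^ (- (m%:R / 2)) : R) ^+ 4 = 2 ^- (2 * m).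
  rewrite -powR_mulrn ?powR_ge0// -powRrM (_ : - (m%:R / 2) * 4%:R = - (2 * m)%:R).
    by rewrite powRN powR_mulrn.
  by rewrite natrM; field.
pose Q : R := max1 K `^ 4^-1 * a `^ (3 / 4) * m%:R `^ (3 / 4) * 2 `^ (- (m%:R / 2)).
have k0 : 0 < max1 K by lra.
have a0 : 0 < a by lra.
have m0 : 0 < m%:R :> R by lra.
have Q0 : 0 < Q by rewrite !mulr_gt0 ?powR_gt0.
have Q4 : Q ^+ 4 * 2 ^+ (2 * m) = max1 K * (m%:R * a) ^+ 3.
  rewrite !exprMn pw1// !pw// p2 mulfVK; last by rewrite expf_eq0 pnatr_eq0 andbF.
  by ring.
have -> : 79 * C * max1 K `^ 4^-1 * a `^ (3 / 4) * m%:R `^ (3 / 4) * 2 `^ (- (m%:R / 2)) = 79 * (C * Q).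
  by rewrite /Q; ring.
move: Q Q0 Q4 => Q Q0 Q4.
have DQ : D <= 11 / 4 * C * (Q * 2 ^+ m).
  have p0 : 0 <= 11 / 4 * C * (Q * 2 ^+ m).
    by apply: mulr_ge0; apply: mulr_ge0; rewrite ?exprn_ge0//; lra.
  rewrite -(@ler_pXn2r _ 4) ?nnegrE//; last exact: ltW.
  have -> : (11 / 4 * C * (Q * 2 ^+ m)) ^+ 4 =
      (11 / 4) ^+ 4 * C ^+ 4 * (Q ^+ 4 * 2 ^+ (2 * m)) * 2 ^+ (2 * m).
    rewrite [2 ^+ (2 * m)](_ : _ = (2 ^+ m) ^+ 2); last by rewrite mulnC exprM.
    by move: (2 ^+ m) (Q) => y q; field.
  rewrite Q4 D4 mulrAC ler_pM2r ?exprn_gt0//.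
  have L3 : L ^+ 3 <= (15 / 4 * C * (m%:R * a)) ^+ 3.
    by rewrite ler_pXn2r// nnegrE; lra.
  apply: (@le_trans _ _ (max1 K * (15 / 4 * C * (m%:R * a)) ^+ 3)).
    by rewrite ler_pM ?exprn_ge0//; lra.
  have -> : max1 K * (15 / 4 * C * (m%:R * a)) ^+ 3 =
     (15 / 4) ^+ 3 * C ^+ 3 * (max1 K * (m%:R * a) ^+ 3) by rewrite !exprMn; ring.
  apply: ler_wpM2r.
    by apply: mulr_ge0; [lra|apply: exprn_ge0; apply: mulr_ge0; lra].
  have C34 : C ^+ 3 <= C ^+ 4 by rewrite [leRHS]exprS ler_peMl ?exprn_ge0//; exact: ltW.
  apply: ler_pM => //; first by rewrite exprn_ge0// ltW.
  exact: numeric_bound.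
have -> : 4 * (13 / 2 * 2 ^- m * D) = 26 * (2 ^- m * D) by field.
have mD : 2 ^- m * D <= 11 / 4 * C * Q.
  by rewrite mulrC ler_pdivrMr ?exprn_gt0//; apply: le_trans DQ _; rewrite !mulrA.
have : 0 < C * Q by rewrite mulr_gt0.
lra.
Qed.

End Numerics.

(** * Interpolation on the triangular mesh *)

Section Interpolation.
Variable R : realType.
Implicit Types (G : nat -> int -> R) (s z t y : R).

(* The interpolation of [walk_local_time] in coordinates where the grid is the
   integer lattice. *)
Definition interpolation G s z : R :=
  let k := Num.truncn s in let j := Num.floor z in
  let a := s - k%:R in let b := z - j%:~R in
  if a <= b then G k j + a * (G k.+1 (j + 1) - G k (j + 1)) + b * (G k (j + 1) - G k j)
  else G k j + a * (G k.+1 j - G k j) + b * (G k.+1 (j + 1) - G k.+1 j).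

Lemma walk_local_timeE (x : nat -> nat -> R) m (p : R * R) :
  walk_local_time x m p =
  interpolation (grid_local_time x m) (p.1 * 2 ^+ (2 * m)) (p.2 * 2 ^+ m).
Proof.
case: p => t y; rewrite /walk_local_time /interpolation /=.
set k := Num.truncn _; set j := Num.floor _; set G := grid_local_time x m.
have T0 : 2 ^+ (2 * m) != 0 :> R by rewrite expf_eq0 pnatr_eq0 andbF.
have Y0 : 2 ^+ m != 0 :> R by rewrite expf_eq0 pnatr_eq0 andbF.
have TY : 2 ^+ (2 * m) = 2 ^+ m * 2 ^+ m :> R by rewrite -exprD addnn mul2n.
have -> : (t - k%:R * 2 ^- (2 * m)) / (k.+1%:R * 2 ^- (2 * m) - k%:R * 2 ^- (2 * m))
    = t * 2 ^+ (2 * m) - k%:R.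
  by rewrite -mulrBl -[k.+1%:R]natr1 addrAC subrr add0r mul1r invrK mulrBl mulfVK.
have -> : (y - j%:~R * 2 ^- m) / ((j + 1)%:~R * 2 ^- m - j%:~R * 2 ^- m)
    = y * 2 ^+ m - j%:~R.
  by rewrite -mulrBl intrD addrAC subrr add0r mul1r invrK mulrBl mulfVK.
congr (if _ then _ else _).
have p0 : 0 < 2 ^+ m :> R by rewrite exprn_gt0.
rewrite TY -lerBrDl -(ler_pM2r p0); congr (_ <= _); last by field.
by field.
Qed.

Lemma cell_fractions s z : 0 <= s ->
  [/\ 0 <= s - (Num.truncn s)%:R, s - (Num.truncn s)%:R < 1,
      0 <= z - (Num.floor z)%:~R & z - (Num.floor z)%:~R < 1].
Proof.
move=> s0; have /andP[h1 h2] := truncn_itv s0; have /andP[h3 h4] := floor_itv z.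
by move: h2 h4; rewrite -natr1 intrD => h2 h4; split; lra.
Qed.

Lemma convex3 (w1 w2 w3 x1 x2 x3 e : R) :
  0 <= w1 -> 0 <= w2 -> 0 <= w3 -> w1 + w2 + w3 = 1 ->
  `|x1| <= e -> `|x2| <= e -> `|x3| <= e -> `|w1 * x1 + w2 * x2 + w3 * x3| <= e.
Proof.
move=> w10 w20 w30 w h1 h2 h3.
apply: le_trans (ler_normD _ _) _; apply: le_trans (lerD (ler_normD _ _) (lexx _)) _.
rewrite !normrM (ger0_norm w10) (ger0_norm w20) (ger0_norm w30).
by rewrite -[leRHS]mul1r -w !mulrDl !lerD// ler_wpM2l.
Qed.

(** On each triangle the interpolation is a convex combination of three corner values, so a bound at
    the corners passes to the interior. *)
Lemma interpolation_near G s z v e : 0 <= s ->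
  (forall k j, (Num.truncn s <= k <= (Num.truncn s).+1)%N ->
     Num.floor z <= j <= Num.floor z + 1 -> `|G k j - v| <= e) ->
  `|interpolation G s z - v| <= e.
Proof.
move=> s0 h; have [a0 a1 b0 b1] := cell_fractions z s0; rewrite /interpolation.
set k := Num.truncn s in h *; set j := Num.floor z in h *.
have h00 := h k j; have h10 := h k.+1 j; have h01 := h k (j + 1); have h11 := h k.+1 (j + 1).
move: h00 h10 h01 h11; rewrite !leqnn !leqnSn !lexx lerDl /= => h00 h10 h01 h11.
move: (s - _) (z - _) a0 a1 b0 b1 => a b a0 a1 b0 b1; case: (leP a b) => ab.
  have -> : G k j + a * (G k.+1 (j + 1) - G k (j + 1)) + b * (G k (j + 1) - G k j) - v =
    (1 - b) * (G k j - v) + a * (G k.+1 (j + 1) - v) + (b - a) * (G k (j + 1) - v) by ring.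
  by apply: convex3; [lra|lra|lra|lra|exact: h00|exact: h11|exact: h01].
have -> : G k j + a * (G k.+1 j - G k j) + b * (G k.+1 (j + 1) - G k.+1 j) - v =
  (1 - a) * (G k j - v) + b * (G k.+1 (j + 1) - v) + (a - b) * (G k.+1 j - v) by ring.
by apply: convex3; [lra|lra|lra|lra|exact: h00|exact: h11|exact: h10].
Qed.

Lemma interpolation_time0 G z : (forall j, G 0%N j = 0) -> interpolation G 0 z = 0.
Proof.
move=> G0; rewrite /interpolation truncn0 mulr0n subrr !mul0r.
have [_ _ -> _] := cell_fractions z (lexx 0).
by rewrite !G0 subrr mulr0 !addr0.
Qed.

(* The piecewise affine function which is 1 at the origin and 0 at the other
   grid points. *)
Definition hat (a b : R) : R :=
  Num.max 0 (1 - Num.max a (Num.max b 0) - Num.max (- a) (Num.max (- b) 0)).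

Lemma max_lipschitz (a b a' b' : R) :
  `|Num.max a b - Num.max a' b'| <= `|a - a'| + `|b - b'|.
Proof.
have := ler_norm (a - a'); have := ler_norm (b - b').
have := ler_norm (a' - a); have := ler_norm (b' - b); rewrite !(distrC a') !(distrC b').
have := normr_ge0 (a - a'); have := normr_ge0 (b - b').
move: `|a - a'| `|b - b'| => x y x0 y0 h1 h2 h3 h4; rewrite ler_norml.
by case: (leP a b); case: (leP a' b') => *; apply/andP; split; lra.
Qed.

Lemma hat_lipschitz (a b a' b' : R) :
  `|hat a b - hat a' b'| <= 2 * (`|a - a'| + `|b - b'|).
Proof.
apply: le_trans (max_lipschitz _ _ _ _) _; rewrite subrr normr0 add0r.
set m1 := Num.max a _; set m2 := Num.max (- a) _; set m3 := Num.max a' _; set m4 := Num.max (- a') _.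
have -> : 1 - m1 - m2 - (1 - m3 - m4) = (m3 - m1) + (m4 - m2) by ring.
apply: le_trans (ler_normD _ _) _; rewrite mulr2n mulrDl mul1r; apply: lerD.
  rewrite distrC; apply: le_trans (max_lipschitz _ _ _ _) _; rewrite lerD2l.
  by apply: le_trans (max_lipschitz _ _ _ _) _; rewrite subrr normr0 addr0.
apply: le_trans (max_lipschitz _ _ _ _) _; apply: lerD; first by rewrite opprK addrC.
by apply: le_trans (max_lipschitz _ _ _ _) _; rewrite subrr normr0 addr0 opprK addrC.
Qed.

Lemma hat_eq0 (a b : R) : [|| 1 <= a, a <= -1, 1 <= b | b <= -1] -> hat a b = 0.
Proof.
have [h1 h2 h3] : [/\ a <= Num.max a (Num.max b 0), b <= Num.max a (Num.max b 0) &
    0 <= Num.max a (Num.max b 0)] by rewrite !le_max !lexx !orbT.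
have [h4 h5 h6] : [/\ - a <= Num.max (- a) (Num.max (- b) 0),
    - b <= Num.max (- a) (Num.max (- b) 0) &
    0 <= Num.max (- a) (Num.max (- b) 0)] by rewrite !le_max !lexx !orbT.
by move=> h; apply/max_idPl; case/or4P: h => h; lra.
Qed.

Lemma hatE (a b p q r : R) : Num.max a (Num.max b 0) = p -> Num.max (- a) (Num.max (- b) 0) = q ->
  Num.max 0 (1 - p - q) = r -> hat a b = r.
Proof. by rewrite /hat => -> ->. Qed.

Lemma max3l (a b : R) : b <= a -> 0 <= a -> Num.max a (Num.max b 0) = a.
Proof. by move=> h1 h2; apply/max_idPl; rewrite ge_max h1 h2. Qed.

Lemma max3m (a b : R) : a <= b -> 0 <= b -> Num.max a (Num.max b 0) = b.
Proof. by move=> h1 h2; rewrite (max_idPl h2); apply/max_idPr. Qed.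

Lemma max3r (a b : R) : a <= 0 -> b <= 0 -> Num.max a (Num.max b 0) = 0.
Proof. by move=> h1 h2; rewrite (max_idPr h2); apply/max_idPr. Qed.

Lemma sum_two (F : nat -> R) n k : (k.+1 < n)%N ->
  (forall i, (i < n)%N -> i <> k -> i <> k.+1 -> F i = 0) ->
  \sum_(0 <= i < n) F i = F k + F k.+1.
Proof.
move=> kn F0; have [kn1 kn2] : (k <= n)%N /\ (k < n)%N by lia.
rewrite (big_cat_nat (n := k))//= big_nat big1 ?add0r; last by move=> i ik; apply: F0; lia.
rewrite big_ltn// big_ltn// big_nat big1 ?addr0// => i ik; apply: F0; lia.
Qed.

(** As a sum of continuous functions the interpolation needs no matching of affine pieces across
    cell borders. [N] is only bounded below, so one sum serves all points near a given one. *)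
Lemma interpolation_hat G s z N : 0 <= s -> (Num.truncn s + 2 <= N)%N ->
  (absz (Num.floor z) + 2 <= N)%N ->
  interpolation G s z = \sum_(0 <= k < N) \sum_(0 <= i < 2 * N)
    G k (i%:Z - N%:Z) * hat (s - k%:R) (z - (i%:Z - N%:Z)%:~R).
Proof.
move=> s0; have := cell_fractions z s0; rewrite /interpolation.
set k := Num.truncn s; set j := Num.floor z => -[a0 a1 b0 b1] kN jN.
set F := fun k' j' => G k' j' * hat (s - k'%:R) (z - j'%:~R).
have [i0 [i0N i0E]] : exists i0 : nat, (i0.+1 < 2 * N)%N /\ i0%:Z - N%:Z = j.
  by exists (absz (j + N%:Z)%R); split; lia.
have i1E : i0.+1%:Z - N%:Z = j + 1 by lia.
have cell k' : \sum_(0 <= i < 2 * N) F k' (i%:Z - N%:Z) = F k' j + F k' (j + 1).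
  rewrite (sum_two i0N) ?i0E ?i1E// => i iN n1 n2; rewrite /F hat_eq0 ?mulr0//.
  have [h|h] : (i%:Z - N%:Z + 1 <= j) \/ (j + 2 <= i%:Z - N%:Z) by lia.
    by move: h; rewrite -(ler_int R) intrD => h; rewrite (_ : 1 <= z - _) ?orbT//; lra.
  by move: h; rewrite -(ler_int R) intrD => h; rewrite (_ : z - _ <= -1) ?orbT//; lra.
rewrite (@eq_big_nat _ _ _ _ _ _ (fun k' => F k' j + F k' (j + 1))) => [|k' _]; last exact: cell.
have kN' : (k.+1 < N)%N by lia.
rewrite (sum_two kN') => [|k' k'N n1 n2]; last first.
  rewrite /F !hat_eq0 ?mulr0 ?addr0//.
    have [h|h] : (k' + 1 <= k)%N \/ (k + 2 <= k')%N by lia.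
      by move: h; rewrite -(ler_nat R) natrD => h; rewrite (_ : 1 <= s - _) ?orbT//; lra.
    by move: h; rewrite -(ler_nat R) natrD => h; rewrite (_ : s - _ <= -1) ?orbT//; lra.
  have [h|h] : (k' + 1 <= k)%N \/ (k + 2 <= k')%N by lia.
    by move: h; rewrite -(ler_nat R) natrD => h; rewrite (_ : 1 <= s - _) ?orbT//; lra.
  by move: h; rewrite -(ler_nat R) natrD => h; rewrite (_ : s - _ <= -1) ?orbT//; lra.
rewrite /F -[k.+1%:R]natr1 intrD.
have -> : s - (k%:R + 1) = s - k%:R - 1 by ring.
have -> : z - (j%:~R + 1) = z - j%:~R - 1 by ring.
move: (s - k%:R) (z - j%:~R) a0 a1 b0 b1 => a b a0 a1 b0 b1.
have [ab|ab] := leP a b.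
  have -> : hat a b = 1 - b.
    apply: (@hatE _ _ b 0); [by apply: max3m; lra
      |by apply: max3r; lra|by rewrite (max_idPr _); lra].
  have -> : hat (a - 1) (b - 1) = a.
    apply: (@hatE _ _ 0 (- (a - 1))); [by apply: max3r; lra
      |by apply: max3l; lra
      |by rewrite (max_idPr _); lra].
  have -> : hat a (b - 1) = b - a.
    apply: (@hatE _ _ a (- (b - 1))); [by apply: max3l; lra
      |by apply: max3m; lra
      |by rewrite (max_idPr _); lra].
  have -> : hat (a - 1) b = 0.
    apply: (@hatE _ _ b (- (a - 1))); [by apply: max3m; lra
      |by apply: max3l; lra
      |by apply/max_idPl; lra].
  by ring.
have ba : b <= a by exact: ltW.
have -> : hat a b = 1 - a.
  apply: (@hatE _ _ a 0); [by apply: max3l; lra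
    |by apply: max3r; lra|by rewrite (max_idPr _); lra].
have -> : hat (a - 1) (b - 1) = b.
  apply: (@hatE _ _ 0 (- (b - 1))); [by apply: max3r; lra
    |by apply: max3m; lra
    |by rewrite (max_idPr _); lra].
have -> : hat a (b - 1) = 0.
  apply: (@hatE _ _ a (- (b - 1))); [by apply: max3l; lra
    |by apply: max3m; lra
    |by apply/max_idPl; lra].
have -> : hat (a - 1) b = a - b.
  apply: (@hatE _ _ b (- (a - 1))); [by apply: max3m; lra
    |by apply: max3l; lra
    |by rewrite (max_idPr _); lra].
by ring.
Qed.

Definition locally_lipschitz (f : R -> R -> R) := forall s z, 0 <= s ->
  exists2 c, 0 <= c & forall s' z', 0 <= s' -> `|s' - s| < 1 -> `|z' - z| < 1 ->
    `|f s' z' - f s z| <= c * (`|s' - s| + `|z' - z|).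

Lemma interpolation_locally_lipschitz G : locally_lipschitz (interpolation G).
Proof.
(* The margin 4 makes the same [N] admissible at all points at distance less than 1. *)
move=> s z s0; set N := (Num.truncn s + absz (Num.floor z) + 4)%N.
exists (\sum_(0 <= k < N) \sum_(0 <= i < 2 * N) `|G k (i%:Z - N%:Z)| * 2).
  by apply: sumr_ge0 => k _; apply: sumr_ge0 => i _; rewrite mulr_ge0.
move=> s' z' s'0 hs hz.
rewrite !(@interpolation_hat _ _ _ N)//; try by rewrite /N; lia.
- rewrite -sumrB mulr_suml; apply: le_trans (ler_norm_sum _ _ _) _; apply: ler_sum => k _.
  rewrite -sumrB mulr_suml; apply: le_trans (ler_norm_sum _ _ _) _; apply: ler_sum => i _.
  rewrite -mulrBr normrM -mulrA ler_wpM2l//; apply: le_trans (hat_lipschitz _ _ _ _) _.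
  have e (x y w : R) : x - w - (y - w) = x - y by ring.
  by rewrite !e.
- suff : (Num.truncn s' <= (Num.truncn s).+1)%N by rewrite /N; lia.
  rewrite -ltnS -(ltr_nat R); have /andP[_ h2] := truncn_itv s0.
  have /andP[h3 _] := truncn_itv s'0; rewrite -[_.+2%:R]natr1.
  by move: hs; rewrite ltr_norml => /andP[_]; lra.
- have /andP[h1 h2] := floor_itv z; have /andP[h3 h4] := floor_itv z'.
  suff : Num.floor z' <= Num.floor z + 1 /\ Num.floor z - 1 <= Num.floor z' by rewrite /N; lia.
  move: hz; rewrite ltr_norml => /andP[z1 z2].
  rewrite -!ltzD1 -!(ltr_int R); move: h2 h4; rewrite !intrD => h2 h4.
  by split; lra.
Qed.

End Interpolation.

(** * The law of the twisted walks *)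

Section Independence.
Context d (Omega : measurableType d) (R : realType).
Variable P : probability Omega R.

Definition Pr (A : set Omega) : R := fine (P A).

Lemma PrE A : measurable A -> P A = (Pr A)%:E.
Proof. by move=> mA; rewrite fineK// fin_num_measure. Qed.

Lemma Pr_setT : Pr setT = 1.
Proof. by rewrite /Pr probability_setT. Qed.

Lemma PrU A B : measurable A -> measurable B -> A `&` B = set0 ->
  Pr (A `|` B) = Pr A + Pr B.
Proof.
move=> mA mB AB; apply: EFin_inj; rewrite EFinD -!PrE//; last exact: measurableU.
by rewrite measureU.
Qed.

Lemma PrID A B : measurable A -> measurable B ->
  Pr A = Pr (A `&` B) + Pr (A `&` ~` B).
Proof.
move=> mA mB; have mBc := measurableC mB; rewrite -PrU; try exact: measurableI.
  by rewrite -setIUr setUCr setIT.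
by rewrite setIACA setICr setI0.
Qed.

Lemma PrD A B : measurable A -> measurable B -> B `<=` A -> Pr (A `\` B) = Pr A - Pr B.
Proof. by move=> mA mB BA; rewrite (PrID mA mB) (setIidr BA) setDE addrAC subrr add0r. Qed.

Lemma le_Pr A B : measurable A -> measurable B -> A `<=` B -> Pr A <= Pr B.
Proof.
move=> mA mB AB; rewrite -lee_fin -!PrE//; apply: le_measure; rewrite ?inE//.
Qed.

Lemma cvg_Pr (F : (set Omega)^nat) : nondecreasing_seq F -> (forall n, measurable (F n)) ->
  Pr (F n) @[n --> \oo] --> Pr (\bigcup_n F n).
Proof.
move=> ndF mF; have mU : measurable (\bigcup_n F n) by exact: bigcup_measurable.
apply: fine_cvg; rewrite -PrE//; exact: nondecreasing_cvg_mu.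
Qed.

Lemma Pr_partition (I : finType) (f : Omega -> I) A : measurable A ->
  (forall i, measurable [set w | f w = i]) ->
  Pr A = \sum_i Pr (A `&` [set w | f w = i]).
Proof.
move=> mA mf.
have key (r : seq I) : uniq r ->
    Pr (A `&` [set w | f w \in r]) = \sum_(i <- r) Pr (A `&` [set w | f w = i])
    /\ measurable [set w | f w \in r].
  elim: r => [_|i r IH /= /andP[ir /IH [IH1 IH2]]].
    rewrite big_nil (_ : [set w | _] = set0) ?setI0; last by rewrite -subset0 => w.
    by split=> //; rewrite /Pr measure0.
  have E : [set w | f w \in i :: r] = [set w | f w = i] `|` [set w | f w \in r].
    apply/seteqP; split=> w /=; rewrite inE; first by case/orP=> [/eqP|]; [left|right].
    by case=> [->|->]; rewrite ?eqxx ?orbT.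
  split; last by rewrite E; exact: measurableU.
  rewrite big_cons -IH1 E setIUr PrU//; try exact: measurableI.
  have dis : [set w | f w = i] `&` [set w | f w \in r] = set0.
    by apply/seteqP; split=> // w [/= -> ]; move/negP : ir.
  by rewrite setIACA setIid dis setI0.
have := (key (enum I) (enum_uniq I)).1; rewrite big_enum /= => <-.
by congr Pr; apply/seteqP; split => w /=; [move=> Aw; rewrite mem_enum|case].
Qed.

Variable X : nat -> nat -> {RV P >-> R}.

Definition cylinder (J : {fset nat * nat}) (B : nat * nat -> set R) : set Omega :=
  \bigcap_(i in [set` J]) (X i.1 i.2 @^-1` B i).

Definition cylinders (S : set (nat * nat)) : set (set Omega) :=
  [set A | exists J B, [/\ [set` J] `<=` S, (forall i, measurable (B i)) & A = cylinder J B]].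

Definition generated (S : set (nat * nat)) : set (set Omega) := <<s cylinders S >>.

Lemma cylinder_measurable J B : (forall i, measurable (B i)) -> measurable (cylinder J B).
Proof.
move=> mB; apply: fin_bigcap_measurable => // i _.
by rewrite -[X in measurable X]setTI; exact: measurable_funP.
Qed.

Lemma generated_measurable S A : generated S A -> measurable A.
Proof.
move=> SA; have : <<s cylinders S >> `<=` @measurable _ Omega.
  apply: smallest_sub; first exact: sigma_algebra_measurable.
  by move=> _ [J [B [_ mB ->]]]; exact: cylinder_measurable.
exact.
Qed.

Lemma cylinder_setI J J' B B' :
  cylinder J B `&` cylinder J' B' = cylinder (J `|` J')%fset
    (fun i => (if i \in J then B i else setT) `&` (if i \in J' then B' i else setT)).
Proof.
apply/seteqP; split => w.
  by move=> [h h'] i /=; rewrite inE => _; split; case: ifPn => // iJ; [exact: h|exact: h'].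
move=> h; split=> i /= iJ.
  by have [] := h i _; rewrite /= ?inE ?iJ.
by have [] := h i _; rewrite /= ?inE ?iJ ?orbT.
Qed.

Lemma cylinders_setI S : setI_closed (cylinders S).
Proof.
move=> _ _ [J [B [JS mB ->]]] [J' [B' [JS' mB' ->]]].
eexists; eexists; split; last exact: cylinder_setI.
  by move=> i /=; rewrite inE => /orP[/JS|/JS'].
by move=> i; apply: measurableI; case: ifP.
Qed.

Hypothesis indep : mutually_independent [set i : nat * nat | (1 <= i.2)%N]
    (fun i => X i.1 i.2).

(** A lambda-pi argument: the events independent of the coordinate form a lambda-system containing
    the cylinders. Finite families alone would not do, because the sign of a block depends on an
    unbounded number of steps. *)
Lemma coordinate_independent (i0 : nat * nat) (S : set (nat * nat)) (B0 : set R) A :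
  (1 <= i0.2)%N -> (forall i, S i -> (1 <= i.2)%N) -> ~ S i0 -> measurable B0 ->
  generated S A ->
  Pr (X i0.1 i0.2 @^-1` B0 `&` A) = Pr (X i0.1 i0.2 @^-1` B0) * Pr A.
Proof.
move=> i01 S1 Si0 mB0; set Y := X i0.1 i0.2 @^-1` B0.
have mY : measurable Y by rewrite /Y -[X in measurable X]setTI; exact: measurable_funP.
pose H := [set A | measurable A /\ Pr (Y `&` A) = Pr Y * Pr A].
suff : generated S `<=` H by move=> h /h[].
apply: lambda_system_subset.
- exact: cylinders_setI.
- split.
  + by [].
  + by split; rewrite ?setIT ?Pr_setT ?mulr1.
  + move=> A1 A2 A21 [mA1 h1] [mA2 h2]; split; first exact: measurableD.
    have -> : Y `&` (A1 `\` A2) = (Y `&` A1) `\` (Y `&` A2).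
      apply/seteqP; split => w; first by move=> [Yw [A1w A2w]]; split=> // -[].
      by move=> [[Yw A1w] A2w]; split=> //; split=> // A2w'; apply: A2w.
    rewrite !PrD//; try exact: measurableI; last by move=> w [Yw /A21].
    by rewrite h1 h2 mulrBr.
  + move=> F ndF HF; have mF n : measurable (F n) by have [] := HF n.
    split; first exact: bigcup_measurable.
    rewrite setI_bigcupr.
    have c1 : Pr (Y `&` F n) @[n --> \oo] --> Pr (\bigcup_n (Y `&` F n)).
      apply: cvg_Pr; last by move=> n; exact: measurableI.
      by move=> m n /ndF mn; rewrite !subsetEset in mn *; exact: setIS.
    have c2 : Pr Y * Pr (F n) @[n --> \oo] --> Pr Y * Pr (\bigcup_n F n).
      by apply: cvgM; [exact: cvg_cst|exact: cvg_Pr].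
    have E : (fun n => Pr (Y `&` F n)) = (fun n => Pr Y * Pr (F n)).
      by apply/funext => n; have [] := HF n.
    rewrite E in c1; rewrite -(cvg_lim (@Rhausdorff R) c1).
    exact: (cvg_lim (@Rhausdorff R) c2).
- move=> _ [J [B [JS mB ->]]]; split; first exact: cylinder_measurable.
  have JA K C : [set` K] `<=` [set i : nat * nat | (1 <= i.2)%N] ->
      (forall i, measurable (C i)) ->
      Pr (cylinder K C) = \prod_(i <- K) Pr (X i.1 i.2 @^-1` C i).
    move=> K1 mC; rewrite /Pr [P _](indep K1 mC).
    rewrite -[RHS]/(fine (\prod_(i <- K) Pr (X i.1 i.2 @^-1` C i))%:E); congr fine.
    rewrite -prodEFin; apply: eq_bigr => i _; rewrite -PrE//.
    by rewrite -[X in measurable X]setTI; exact: measurable_funP.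
  have i0J : i0 \notin J by apply/negP => /JS.
  have YE : Y = cylinder [fset i0]%fset (fun=> B0).
    apply/seteqP; split => w; first by move=> Yw i /=; rewrite inE => /eqP ->.
    by move=> /(_ i0); apply; rewrite /= inE.
  have -> : Y `&` cylinder J B = cylinder (i0 |` J)%fset (fun i => if i == i0 then B0 else B i).
    apply/seteqP; split => w.
      move=> [Yw Jw] i /=; rewrite inE => /orP[|iJ]; first by rewrite inE => /eqP ->; rewrite eqxx.
      by case: eqP => [->//|_]; exact: Jw.
    move=> h; split; first by have := h i0; rewrite /= eqxx; apply; rewrite !inE eqxx.
    move=> i /= iJ; have := h i; rewrite /=; case: eqP => [e|_]; last by apply; rewrite !inE iJ orbT.
    by move: i0J; rewrite -e iJ.
  rewrite !JA//.
  + rewrite big_fsetU1//= eqxx; congr (_ * _).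
    apply: eq_big_seq => i iJ; case: eqP => // e; by move: i0J; rewrite -e iJ.
  + by move=> i /= /JS /S1.
  + by move=> i /=; rewrite !inE => /orP[/eqP ->//|/JS /S1].
  + by move=> i; case: ifP.
- by move=> A1 /generated_measurable _ w.
Qed.

End Independence.

(** * Events read off boolean paths *)

Section DiscreteEvents.
Variables (Omega : Type) (S : set (set Omega)).
Hypothesis hS : sigma_algebra setT S.
Implicit Types (f g : Omega -> bool) (e : Omega -> nat -> bool).

(** [S] is left open because the rules are applied both to all measurable sets and to the
    sigma-algebras generated by some of the steps. *)
Definition event f := S [set w | f w].

Lemma eq_event f g : f =1 g -> event f -> event g.
Proof. by move=> /funext ->. Qed.

Lemma sigma_setC A : S A -> S (~` A).
Proof. by move=> SA; rewrite -setTD; case: hS => _ + _; exact. Qed.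

Lemma sigma_bigcup (F : (set Omega)^nat) : (forall n, S (F n)) -> S (\bigcup_n F n).
Proof. by case: hS => _ _; exact. Qed.

Lemma sigma_setU A B : S A -> S B -> S (A `|` B).
Proof.
move=> SA SB; rewrite -bigcup2E; apply: sigma_bigcup => -[|[|n]] //=.
by case: hS.
Qed.

Lemma sigma_setI A B : S A -> S B -> S (A `&` B).
Proof.
by move=> SA SB; rewrite -[A]setCK -[B]setCK -setCU; apply/sigma_setC/sigma_setU; exact: sigma_setC.
Qed.

Lemma eventN f : event f -> event (fun w => ~~ f w).
Proof.
move=> /sigma_setC; rewrite /event; congr S.
by apply/seteqP; split => w /=; [move=> /negP|move=> ?; apply/negP].
Qed.

Lemma event_cst b : event (fun=> b).
Proof.
have h : event (fun=> false).
  rewrite /event (_ : [set _ | _] = set0); first by case: hS.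
  by apply/seteqP; split.
by case: b => //; exact: (eventN h).
Qed.

Lemma eventI f g : event f -> event g -> event (fun w => f w && g w).
Proof.
move=> ef eg; have := sigma_setI ef eg; congr S.
by apply/seteqP; split => w /=; [move=> [-> ->]|move=> /andP].
Qed.

Lemma eventU f g : event f -> event g -> event (fun w => f w || g w).
Proof.
move=> ef eg; have := sigma_setU ef eg; congr S.
by apply/seteqP; split => w /=; [move=> ?; apply/orP|move=> /orP].
Qed.

Lemma event_addb f g : event f -> event g -> event (fun w => f w (+) g w).
Proof.
move=> ef eg; apply: (@eq_event (fun w => (f w && ~~ g w) || (~~ f w && g w))).
  by move=> w; case: (f w); case: (g w).
by apply: eventU; apply: eventI => //; exact: eventN.
Qed.

Lemma event_exists (f : nat -> Omega -> bool) : (forall n, event (f n)) ->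
  event (fun w => `[< exists n, f n w >]).
Proof.
move=> ef; have := sigma_bigcup ef; congr S.
by apply/seteqP; split => w /=; [move=> [n _ fn]; apply/asboolP; exists n|move=> /asboolP[n fn]; exists n].
Qed.

Lemma event_all (I : Type) (f : I -> Omega -> bool) (r : seq I) :
  (forall i, event (f i)) -> event (fun w => all (f^~ w) r).
Proof.
move=> ef; elim: r => [|i r IH]; first exact: (event_cst true).
exact: (eventI (ef i) IH).
Qed.

Definition steps_in e := forall k, (0 < k)%N -> event (e^~ k).

(** Only the steps up to [n] are asked for, since [Pr_hist_bits] works in a sigma-algebra that omits
    the next step. *)
Lemma event_hist_le e n (Q : pred (seq bool)) :
  (forall k, (0 < k <= n)%N -> event (e^~ k)) -> event (fun w => Q (hist (e w) n)).
Proof.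
elim: n Q => [|n IH] Q ee; first exact: (event_cst (Q [::])).
apply: (@eq_event (fun w => (e w n.+1 && Q (true :: hist (e w) n)) ||
                            (~~ e w n.+1 && Q (false :: hist (e w) n)))).
  by move=> w /=; case: (e w n.+1); rewrite ?orbF.
have en : event (e^~ n.+1) by apply: ee; rewrite ltnS leqnn.
have {}IH Q' : event (fun w => Q' (hist (e w) n)).
  by apply: IH => k /andP[k0 kn]; apply: ee; rewrite k0 ltnW.
by apply: eventU; apply: eventI; [|exact: (IH (Q \o cons true))|exact: eventN|
  exact: (IH (Q \o cons false))].
Qed.

Lemma event_hist e n (Q : pred (seq bool)) : steps_in e -> event (fun w => Q (hist (e w) n)).
Proof. by move=> ee; apply: event_hist_le => k /andP[/ee]. Qed.

Lemma event_turn e k : steps_in e -> event (fun w => turn (e w) k).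
Proof.
move=> ee; pose Q s := if s is b :: s' then [&& blocks s' == k, closes b s' & b] else false.
apply: eq_event (event_exists (fun n => event_hist n.+1 Q ee)) => w /=.
by apply/asboolP/asboolP => -[n]; [move=> /and3P[/eqP]|move=> [/eqP ? ? ?]]; exists n;
  [|apply/and3P].
Qed.

Lemma steps_in_twist b c : steps_in b -> steps_in c ->
  steps_in (fun w => twist (b w) (c w)).
Proof.
move=> eb ec [//|n] _.
have := event_exists (fun k => eventI (event_hist n (fun s => blocks s == k) eb)
  (event_addb (eb n.+1 isT) (event_addb (event_turn k eb) (ec k.+1 isT)))).
apply: eq_event => w; apply/asboolP/idP => [[k /andP[/eqP <-]]//|h].
by exists (blocks (hist (b w) n)); rewrite eqxx.
Qed.

End DiscreteEvents.

Fixpoint nested (e : nat -> nat -> bool) (m : nat) : nat -> bool :=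
  if m is m'.+1 then twist (e m) (nested e m') else e 0%N.

(* Recovers the untwisted steps from the twisted path, g k telling whether the
   k-th block has been flipped. *)
Fixpoint untwist (g : nat -> bool) (s : seq bool) : seq bool :=
  if s is b :: s' then (b (+) g (blocks s')) :: untwist g s' else [::].

Lemma size_untwist g s : size (untwist g s) = size s.
Proof. by elim: s => //= b s ->. Qed.

(** Twisting is invertible once the flips are known, and a path of [N] steps meets at most [N]
    blocks, so the first [N] flips suffice. *)
Lemma hist_twist b c g N s : (forall k, (k < N)%N -> g k = turn b k (+) c k.+1) ->
  size s = N -> (hist (twist b c) N = s) <-> (hist b N = untwist g s).
Proof.
elim: N s => [|N IH] [|x s] //= gE [sN].
have {}IH := IH s (fun k kN => gE k (ltnW kN)) sN.
have kE : blocks (hist (twist b c) N) = blocks (hist b N) by have [] := twist_shape b c N.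
have gk : g (blocks (hist b N)) = turn b (blocks (hist b N)) (+) c (blocks (hist b N)).+1.
  by apply: gE; rewrite ltnS blocks_le.
split=> -[h1 h2].
  have h3 : hist b N = untwist g s by apply/IH.
  congr cons => //; rewrite -h1 -h2 kE /twist /= gk; by rewrite addbK.
have h3 : hist (twist b c) N = s by apply/IH.
congr cons => //; rewrite /twist /= h1 -gk -kE h3; by rewrite addbK.
Qed.

Section NestedLaw.
Context d (Omega : measurableType d) (R : realType).
Variables (P : probability Omega R) (X : nat -> nat -> {RV P >-> R}).
Hypothesis iid : iid_signs X.

Definition bits (w : Omega) (m k : nat) : bool := X m k w == 1.

Definition levels (m : nat) : set (nat * nat) := [set i | (m <= i.1)%N /\ (1 <= i.2)%N].

Lemma generated_sigma S : sigma_algebra setT (generated X S).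
Proof. exact: smallest_sigma_algebra. Qed.

Lemma generated_bit (S : set (nat * nat)) m k : S (m, k) -> generated X S [set w | bits w m k].
Proof.
move=> Smk; apply: sub_sigma_algebra; exists [fset (m, k)]%fset, (fun=> [set 1]).
split=> //; first by move=> i /=; rewrite inE => /eqP ->.
apply/seteqP; split => w /=; first by move=> /eqP h i /=; rewrite inE => /eqP ->.
by move=> /(_ (m, k)) h; apply/eqP; apply: h; rewrite /= inE.
Qed.

Lemma generated_sub S S' : S `<=` S' -> generated X S `<=` generated X S'.
Proof.
move=> SS'; apply: sub_sigma_algebra2 => _ [J [B [JS mB ->]]].
by exists J, B; split=> // i /JS /SS'.
Qed.

Lemma Pr_bit m k b (S : set (nat * nat)) A : (1 <= k)%N -> S `<=` levels 0 -> ~ S (m, k) ->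
  generated X S A -> Pr P ([set w | bits w m k = b] `&` A) = Pr P A / 2.
Proof.
move=> k1 S1 Smk SA; have [ind law] := iid; have [law1 _] := law m k k1.
have mA := generated_measurable SA.
have S1' i : S i -> (1 <= i.2)%N by move=> /S1[].
have m1 : measurable [set w | bits w m k].
  apply: (@generated_measurable _ _ _ _ X setT); exact: generated_bit.
have half : Pr P ([set w | bits w m k] `&` A) = Pr P A / 2.
  have := @coordinate_independent _ _ _ P X ind (m, k) S [set 1] A k1 S1' Smk (measurable_set1 1) SA.
  rewrite /= (_ : X m k @^-1` [set 1] = [set w | bits w m k]); last first.
    by apply/seteqP; split => w /= /eqP.
  move=> ->; rewrite mulrC; congr (_ * _); rewrite /Pr -[2^-1]/(fine (2^-1)%:E) -law1.
  by congr (fine (P _)); apply/seteqP; split => w /= /eqP.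
case: b => //; have := PrID P mA m1; rewrite [A `&` _]setIC half.
rewrite (_ : [set w | bits w m k = false] `&` A = A `&` ~` [set w | bits w m k]); first lra.
by rewrite setIC; congr (_ `&` _); apply/seteqP; split => w /=; [move=> ->|move=> /negP/negbTE].
Qed.

Lemma Pr_hist_bits m N s A : size s = N -> generated X (levels m.+1) A ->
  Pr P ([set w | hist (bits w m) N = s] `&` A) = 2 ^- N * Pr P A.
Proof.
move=> + hA; elim: N s => [|N IH] [|b s] //=.
  by move=> _; rewrite expr0 invr1 mul1r (_ : [set _ | _] = setT) ?setTI//; apply/seteqP; split.
move=> [sN]; pose S := [set i : nat * nat | levels m i /\ i <> (m, N.+1)].
have -> : [set w | bits w m N.+1 :: hist (bits w m) N = b :: s] =
    [set w | bits w m N.+1 = b] `&` [set w | hist (bits w m) N = s].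
  by apply/seteqP; split => w /= -[-> ->].
rewrite -setIA (@Pr_bit _ _ _ S) ?IH//.
- by rewrite exprSr invfM; lra.
- by move=> i [[_ i2] _].
- by move=> [].
apply: (sigma_setI (generated_sigma S)).
  rewrite (_ : [set w | _] = [set w | hist (bits w m) N == s]); last first.
    by apply/seteqP; split => w /= /eqP.
  apply: (@event_hist_le _ _ (generated_sigma S) (fun w => bits w m) N (pred1 s)) => k /andP[k0 kN].
  by apply: generated_bit; split=> // -[kE]; move: kN; rewrite kE ltnn.
apply: generated_sub hA => i [i1 i2]; split; first by split=> //; exact: ltnW.
by move=> iE; move: i1; rewrite iE ltnn.
Qed.

Lemma bits_in m : steps_in (generated X (levels m)) (fun w => bits w m).
Proof. by move=> k k0; exact: generated_bit. Qed.

Lemma nested_in m : steps_in (@measurable _ Omega) (fun w => nested (bits w) m).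
Proof.
have mb k : steps_in (@measurable _ Omega) (fun w => bits w k).
  by move=> j j0; apply: (@generated_measurable _ _ _ _ X (levels k)); exact: bits_in.
elim: m => [|m IH]; first exact: mb.
by apply: steps_in_twist => //; exact: sigma_algebra_measurable.
Qed.

Lemma measurable_hist_nested m N (Q : pred (seq bool)) :
  measurable [set w | Q (hist (nested (bits w) m) N)].
Proof.
exact: (event_hist (sigma_algebra_measurable Omega) N Q (nested_in m)).
Qed.

(** Sign patterns are finite functions because [Pr_partition] sums over a finite type; this and
    [restrict] pass between them and sequences. *)
Definition extend N (a : {ffun 'I_N -> bool}) (k : nat) : bool :=
  if insub k is Some i then a i else false.

Definition restrict N (a : nat -> bool) : {ffun 'I_N -> bool} := [ffun i => a (val i)].

Lemma restrictP N (a : nat -> bool) (b : {ffun 'I_N -> bool}) :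
  restrict N a = b <-> forall k, (k < N)%N -> a k = extend b k.
Proof.
split=> [<- k kN|h].
  by rewrite /extend insubT ffunE.
apply/ffunP => i; rewrite ffunE h; last exact: ltn_ord.
by rewrite /extend; case: insubP => [j _ /val_inj -> //|]; rewrite ltn_ord.
Qed.

Lemma hist_extend N (c : nat -> bool) (a : {ffun 'I_N -> bool}) :
  restrict N (fun k => c k.+1) = a <-> hist c N = hist (fun k => extend a k.-1) N.
Proof.
rewrite restrictP; move: (extend a) => g; elim: N {a} => [|n IH] //=; split=> [h|[h1 /IH h2] k].
  congr cons; first exact: h.
  by apply/IH => k kn; exact/h/ltnW.
by rewrite ltnS leq_eqVlt => /orP[/eqP ->//|]; exact: h2.
Qed.

(* A is an event of the higher levels: the induction needs the law of the walk
   of level m given the signs of the blocks of level m + 1. *)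
Lemma Pr_hist_nested m N s A : size s = N -> generated X (levels m.+1) A ->
  Pr P ([set w | hist (nested (bits w) m) N = s] `&` A) = 2 ^- N * Pr P A.
Proof.
elim: m N s A => [|m IH] N s A sN hA; first exact: Pr_hist_bits.
pose b w := bits w m.+1; pose c w := nested (bits w) m.
pose sg w := restrict N (turn (b w)); pose al w := restrict N (fun k => c w k.+1).
have sigG := generated_sigma (levels m.+1).
have hA' : generated X (levels m.+1) A by apply: generated_sub hA => i [/ltnW].
have gsg g : generated X (levels m.+1) [set w | sg w = g].
  have -> : [set w | sg w = g] =
      [set w | all (fun k => turn (b w) k (+) ~~ extend g k) (iota 0 N)].
    apply/seteqP; split => w /=.
      move=> /restrictP h; apply/allP => k; rewrite mem_iota add0n => /h ->.
      by case: extend.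
    move=> /allP h; apply/restrictP => k kN; have := h k; rewrite mem_iota add0n => /(_ kN).
    by case: extend; case: turn.
  apply: (event_all sigG) => k; apply: (event_addb sigG); last exact: event_cst.
  exact: (event_turn sigG k (@bits_in m.+1)).
have gb t : generated X (levels m.+1) [set w | hist (b w) N = t].
  rewrite (_ : [set w | _] = [set w | hist (b w) N == t]); last first.
    by apply/seteqP; split => w /= /eqP.
  exact: (event_hist sigG N (pred1 t) (@bits_in m.+1)).
have alE g : [set w | al w = g] = [set w | hist (c w) N = hist (fun k => extend g k.-1) N].
  by apply/seteqP; split => w /= /hist_extend.
have mf : measurable [set w | hist (nested (bits w) m.+1) N = s].
  rewrite (_ : [set w | _] = [set w | hist (nested (bits w) m.+1) N == s]); last first.
    by apply/seteqP; split => w /= /eqP.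
  exact: (measurable_hist_nested m.+1 N (pred1 s)).
have mc t : measurable [set w | hist (c w) N = t].
  rewrite (_ : [set w | _] = [set w | hist (c w) N == t]); last first.
    by apply/seteqP; split => w /= /eqP.
  exact: (measurable_hist_nested m N (pred1 t)).
have mA := generated_measurable hA.
have mal g : measurable [set w | al w = g] by rewrite alE.
have msg g : measurable [set w | sg w = g] by exact: generated_measurable (gsg g).
pose xor (x y : {ffun 'I_N -> bool}) : {ffun 'I_N -> bool} := [ffun i => x i (+) y i].
have xorK y : cancel (xor^~ y) (xor^~ y) by move=> x; apply/ffunP => i; rewrite !ffunE addbK.
have key g h w : sg w = g -> al w = h -> forall k, (k < N)%N ->
    extend (xor h g) k = turn (b w) k (+) c w k.+1.
  move=> /restrictP e1 /restrictP e2 k kN.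
  have <- : extend h k = c w k.+1 by rewrite -e2.
  by rewrite e1// /extend insubT ffunE addbC.
have step g h : Pr P ([set w | hist (nested (bits w) m.+1) N = s] `&` A
      `&` [set w | sg w = g] `&` [set w | al w = h])
    = 2 ^- N * Pr P ([set w | hist (b w) N = untwist (extend (xor h g)) s] `&` A
      `&` [set w | sg w = g]).
  rewrite -(IH N (hist (fun k => extend h k.-1) N)) ?size_hist//; last first.
    by apply: (sigma_setI sigG) => //; apply: (sigma_setI sigG).
  rewrite -alE setIC; congr (Pr P _); apply/seteqP; split => w /= [aw [[hw Aw] sw]]; do 3?split=> //.
    exact/(hist_twist (key _ _ _ sw aw) sN).
  exact/(hist_twist (key _ _ _ sw aw) sN).
rewrite (@Pr_partition _ _ _ P _ sg)//; last exact: measurableI.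
under eq_bigr => g _.
  rewrite (@Pr_partition _ _ _ P _ al)//; last by do 2?apply: measurableI.
  under eq_bigr => h _ do rewrite step.
  (* For fixed turns [g] the coarse steps and the flips determine each other, so the sum may run
     over the flips. *)
  rewrite (reindex_inj (can_inj (xorK g))).
  under eq_bigr => h _ do rewrite (xorK g).
  over.
rewrite exchange_big /=.
under eq_bigr => h _.
  rewrite -mulr_sumr -(@Pr_partition _ _ _ P _ sg)//; last exact: measurableI (generated_measurable (gb _)) mA.
  rewrite Pr_hist_bits ?size_untwist//; over.
(* The [2 ^ N] flip patterns cancel one of the two factors [2 ^- N]: one came from the coarse steps,
   the other from the untwisted ones. *)
rewrite sumr_const card_ffun card_bool card_ord -[_ *+ (2 ^ N)]mulr_natl natrX mulrA.
by rewrite mulfV ?mul1r// expf_eq0 pnatr_eq0 andbF.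
Qed.

End NestedLaw.

(** * Hitting times and blocks *)

Section Encoding.
Variables (R : realType) (x : nat -> nat -> R).

Definition up_steps (m k : nat) : bool := x m k == 1.

Hypothesis signs : forall m k, (1 <= k)%N -> x m k = 1 \/ x m k = - 1.
Hypothesis unbounded : forall m k, exists i, (k < blocks (hist (up_steps m) i))%N.

Lemma sign_sgb m k : (1 <= k)%N -> x m k = (sgb (up_steps m k))%:~R.
Proof.
move=> k1; rewrite /up_steps /sgb; case: eqP => [->//|].
by case: (signs m k1) => [->//|->]; rewrite mulrN1z.
Qed.

Lemma walk_pos m n : walk x m n = (pos (hist (up_steps m) n))%:~R.
Proof.
rewrite /walk; elim: n => [|n IH]; first by rewrite big_geq.
by rewrite big_nat_recr//= IH intrD sign_sgb.
Qed.

Lemma walk_dist2 m i j : `|walk x m i - walk x m j| = 2 <->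
  absz (pos (hist (up_steps m) i) - pos (hist (up_steps m) j))%R = 2%N.
Proof.
rewrite !walk_pos -intrB -intr_norm -[2]/(2%:~R : R); split=> [/intr_inj|h]; first by lia.
by congr (_%:~R); lia.
Qed.

Lemma least_eq (A : set nat) n : A n -> (forall i, A i -> (n <= i)%N) -> least A = n.
Proof.
move=> An nA; apply: xget_unique => //= i [Ai iA]; apply/eqP; rewrite eqn_leq.
by rewrite (iA _ An) (nA _ Ai).
Qed.

Section Hitting.
Variable m : nat.
Let b := up_steps m.

(** Until the first time [n] with more than [k] completed blocks the anchor remains the position at
    [t], so [n] is also the first time at distance 2 from that position. *)
Lemma hit_next k : let t := hit x m k in let u := hit x m k.+1 in
  blocks (hist b t) = k -> anchor (hist b t) = pos (hist b t) ->
  [/\ (t < u)%N, blocks (hist b u) = k.+1, anchor (hist b u) = pos (hist b u),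
      forall i, (i < u)%N -> (blocks (hist b i) <= k)%N &
      pos (hist b u) = pos (hist b t) + 2 * sgb (turn b k)].
Proof.
move=> t u bt at_; have [n kn nmin] := ex_minnP (unbounded m k).
have tn : (t < n)%N by rewrite ltnNge; apply/negP => /(blocks_mono b); rewrite bt leqNgt kn.
have mid i : (t <= i < n)%N -> blocks (hist b i) = k /\ anchor (hist b i) = pos (hist b t).
  move=> /andP[ti]; rewrite -(subnK ti); elim: (i - t)%N => [_|j IH jn]; first by split.
  have [IH1 IH2] := IH (ltnW jn).
  have le : (blocks (hist b (j.+1 + t)) <= k)%N.
    by rewrite leqNgt; apply/negP => /nmin; rewrite leqNgt jn.
  move: le; rewrite addSn [hist b _.+1]/= blocks_cons anchor_cons IH1.
  by case: ifP; rewrite ?add1n ?ltnn// add0n.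
have [n1 nE] : exists n1, n = n1.+1 by exists n.-1; rewrite prednK//; exact: leq_ltn_trans tn.
have [b1 a1] : blocks (hist b n1) = k /\ anchor (hist b n1) = pos (hist b t).
  by apply: mid; rewrite nE leqnn -ltnS -nE tn.
have cl : closes (b n) (hist b n1).
  move: kn; rewrite nE [hist b _]/= blocks_cons b1; case: closes => //; by rewrite add0n ltnn.
have un : u = n.
  rewrite /u /=; apply: least_eq => [/=|i /= [ti /walk_dist2 di]].
    split=> //; apply/walk_dist2; rewrite -/t -/b nE /= -a1 -nE; exact/eqP.
  rewrite leqNgt; apply/negP => i_n; have [_ ai] := mid i (introT andP (conj (ltnW ti) i_n)).
  by have := pos_anchor (hist b i); rewrite ai -/b -/t di.
rewrite un; split=> //.
- by rewrite nE [hist b _]/= blocks_cons -nE cl b1.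
- by rewrite nE [hist b _]/= anchor_cons -nE cl.
- by move=> i; rewrite nE ltnS => /(blocks_mono b); rewrite b1.
have tr : turn b k = b n by rewrite -b1 nE turnE// -nE.
rewrite tr nE [hist b _]/= -nE -a1 /=; move: cl (pos_anchor (hist b n1)); rewrite /closes.
by move: (pos _) (anchor _) => p q; rewrite /sgb; case: (b n); lia.
Qed.

Lemma hit_blocks k : blocks (hist b (hit x m k)) = k /\
  anchor (hist b (hit x m k)) = pos (hist b (hit x m k)).
Proof. by elim: k => // k [h1 h2]; have [] := hit_next h1 h2. Qed.

Lemma hit_block n k : (1 <= n)%N ->
  (hit x m k < n <= hit x m k.+1)%N <-> blocks (hist b n.-1) = k.
Proof.
case: n => // n _; rewrite ltnS /=; have [h1 h2] := hit_blocks k.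
have [_ h3 _ h4 _] := hit_next h1 h2; split=> [/andP[kn nk]|nk].
  by apply/eqP; rewrite eqn_leq h4// -{1}h1 blocks_mono.
apply/andP; split.
  case: k nk h1 h2 h3 h4 => [//|k] nk h1 h2 h3 h4; rewrite leqNgt; apply/negP.
  have [g1 g2] := hit_blocks k; have [_ _ _ g3 _] := hit_next g1 g2.
  by move=> /g3; rewrite nk ltnn.
by rewrite ltnNge; apply/negP => /(blocks_mono b); rewrite nk h3 ltnn.
Qed.

End Hitting.

(** The existential in [twisted_step] has one witness, the number of blocks completed before step
    [n]; its equation then says that the turn of this block equals the coarse step. *)
Lemma twisted_step_sgb m n : (1 <= n)%N ->
  twisted_step x m n = (sgb (nested up_steps m n))%:~R.
Proof.
elim: m n => [|m IH] n n1; first exact: sign_sgb.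
rewrite /= /twist; set b := up_steps m.+1; set k := blocks (hist b n.-1).
have kE : (hit x m.+1 k < n <= hit x m.+1 k.+1)%N by apply/hit_block.
have [h1 h2] := hit_blocks m.+1 k; have [_ _ _ _ h3] := hit_next h1 h2.
have dE : walk x m.+1 (hit x m.+1 k.+1) - walk x m.+1 (hit x m.+1 k) = 2 * (sgb (turn b k))%:~R.
  by rewrite !walk_pos h3 intrD intrM addrAC subrr add0r.
set t := turn b k; set c := nested up_steps m k.+1.
have cond : `[< exists k, (hit x m.+1 k < n <= hit x m.+1 k.+1)%N /\
    walk x m.+1 (hit x m.+1 k.+1) - walk x m.+1 (hit x m.+1 k)
      = 2 * twisted_step x m k.+1 >] = (t == c).
  apply/asboolP/eqP => [[k' [k'E]]|tc].
    have <- : k = k' by apply/hit_block.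
    rewrite dE IH// => /mulfI -/(_ _)/intr_inj; rewrite pnatr_eq0 => /(_ isT).
    by rewrite -/t -/c /sgb; case: t; case: c.
  by exists k; split=> //; rewrite dE IH// -/t -/c tc.
move: cond => /= ->; rewrite sign_sgb// -/b -/t -/c /sgb.
by case: (b n); case: t; case: c; rewrite /= ?mulrN1z ?opprK.
Qed.

Lemma twisted_walk_pos m n :
  twisted_walk x m n = (pos (hist (nested up_steps m) n))%:~R.
Proof.
rewrite /twisted_walk; elim: n => [|n IH]; first by rewrite big_geq.
by rewrite big_nat_recr//= IH intrD twisted_step_sgb.
Qed.

Lemma visits_occupation m k z :
  visits x m k z = occupation z (hist (nested up_steps m) k).
Proof.
rewrite /visits; elim: k => // k IH.
rewrite -addn1 iotaD count_cat IH /= addn0 add0n addn1 /= occupation_cons addnC.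
by rewrite twisted_walk_pos (inj_eq (@intr_inj R)).
Qed.

End Encoding.

(** * The limit process *)

Section Limits.
Variable R : realType.

Lemma geometric_step (u eps : nat -> R) m :
  (forall j, (m <= j)%N -> `|u j.+1 - u j| <= eps j) ->
  (forall j, (m <= j)%N -> eps j.+1 <= 3 / 4 * eps j) ->
  forall j n, (m <= j)%N -> `|u (j + n)%N - u j| <= 4 * eps j.
Proof.
move=> ue e34 j n mj.
have e0 i : (m <= i)%N -> 0 <= eps i by move=> /ue; exact: le_trans.
(* The subtracted term makes the bound telescope, as [eps i <= 4 (eps i - eps i.+1)]. *)
suff : `|u (j + n)%N - u j| <= 4 * eps j - 4 * eps (j + n)%N.
  by have := e0 (j + n)%N (leq_trans mj (leq_addr _ _)); lra.
elim: n => [|n IH]; first by rewrite addn0 subrr normr0 subrr.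
have jn : (m <= j + n)%N by exact: leq_trans (leq_addr _ _).
rewrite addnS; have := ue _ jn; have := e34 _ jn.
have -> : u (j + n).+1 - u j = (u (j + n).+1 - u (j + n)%N) + (u (j + n)%N - u j) by ring.
move=> h1 h2; apply: le_trans (ler_normD _ _) _; lra.
Qed.

Lemma geometric_le (eps : nat -> R) m :
  (forall j, (m <= j)%N -> eps j.+1 <= 3 / 4 * eps j) ->
  forall n, eps (m + n)%N <= eps m * (3 / 4) ^+ n.
Proof.
move=> e34; elim=> [|n IH]; first by rewrite addn0 expr0 mulr1.
rewrite addnS exprS mulrCA; apply: le_trans (e34 _ (leq_addr n m)) _.
by rewrite ler_wpM2l.
Qed.

Lemma geometric_small (eps : nat -> R) m e : 0 < e ->
  (forall j, (m <= j)%N -> 0 <= eps j) ->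
  (forall j, (m <= j)%N -> eps j.+1 <= 3 / 4 * eps j) ->
  exists2 M, (m <= M)%N & forall j, (M <= j)%N -> eps j < e.
Proof.
move=> e_gt0 e0 e34.
have : eps m * (3 / 4) ^+ n @[n --> \oo] --> eps m * 0.
  apply: cvgM; first exact: cvg_cst.
  by apply: cvg_expr; rewrite ger0_norm; lra.
rewrite mulr0 => /cvgr0Pnorm_lt /(_ e e_gt0) [N _ hN].
exists (m + N)%N; first exact: leq_addr.
move=> j mj; rewrite -(subnKC (leq_trans (leq_addr N m) mj)).
apply: le_lt_trans (geometric_le e34 _) _; apply: le_lt_trans (ler_norm _) _.
by apply: hN => /=; lia.
Qed.

Lemma geometric_cvg (u eps : nat -> R) m :
  (forall j, (m <= j)%N -> `|u j.+1 - u j| <= eps j) ->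
  (forall j, (m <= j)%N -> eps j.+1 <= 3 / 4 * eps j) ->
  cvgn u /\ (forall j, (m <= j)%N -> `|limn u - u j| <= 4 * eps j).
Proof.
move=> ue e34.
have e0 i : (m <= i)%N -> 0 <= eps i by move=> /ue; exact: le_trans.
have cu : cvgn u.
  apply/cauchy_cvgP/cauchy_exP => e e_gt0.
  have e4 : 0 < e / 4 by rewrite divr_gt0.
  have [M mM hM] := geometric_small e4 e0 e34.
  exists (u M); exists M => // j /= Mj; rewrite -ball_normE /= distrC -(subnKC Mj).
  by apply: le_lt_trans (geometric_step ue e34 _ mM) _; have := hM M (leqnn _); lra.
split=> // j mj.
have c : `|u n - u j| @[n --> \oo] --> `|limn u - u j|.
  by apply: cvg_norm; apply: cvgB => //; exact: cvg_cst.
have c2 : (fun=> 4 * eps j) @ \oo --> 4 * eps j by exact: cvg_cst.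
apply: ler_cvg_to c c2 _.
by exists j => // n /= jn; rewrite -(subnKC jn); exact: geometric_step ue e34 _ _ mj.
Qed.

Lemma uniform_cvgP (T : choiceType) (A : set T) (f : nat -> T -> R) (g : T -> R) :
  (forall e, 0 < e -> exists N, forall n, (N <= n)%N -> forall p, A p -> `|f n p - g p| < e) ->
  {uniform A, f @ \oo --> g}.
Proof.
move=> h Q /uniform_nbhs[E [entE EQ]].
move: entE; rewrite -entourage_ballE => -[e /= e0 eE].
have [N hN] := h e e0; exists N => // n /= Nn; apply: EQ => p Ap; apply: eE => /=.
by rewrite -ball_normE /= distrC; exact: hN.
Qed.

Definition jointly_continuous (f : R * R -> R) := forall p, 0 <= p.1 ->
  forall e, 0 < e -> exists2 dl, 0 < dl & forall q, 0 <= q.1 ->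
    `|q.1 - p.1| < dl -> `|q.2 - p.2| < dl -> `|f q - f p| < e.

Lemma within_continuous (f : R * R -> R) : jointly_continuous f ->
  {within [set p : R * R | 0 <= p.1], continuous f}.
Proof.
move=> h; apply/subspace_continuousP => p p0; apply/cvgrPdist_lt => e e0.
have [dl dl0 H] := h p p0 e e0.
have : nbhs p (ball p dl) by exact: nbhsx_ballx.
apply: filterS => q [/= h1 h2] q0; rewrite distrC; apply: H => //.
  by move: h1; rewrite -ball_normE /= distrC.
by move: h2; rewrite -ball_normE /= distrC.
Qed.

Lemma jointly_continuous_uniform_limit (f : nat -> R * R -> R) (g : R * R -> R) :
  (forall n, jointly_continuous (f n)) ->
  (forall K e, 0 < e -> exists n, forall p, 0 <= p.1 <= K -> `|g p - f n p| < e) ->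
  jointly_continuous g.
Proof.
move=> fc fg p p0 e e0; have e3 : 0 < e / 3 by rewrite divr_gt0.
have [n hn] := fg (p.1 + 1) (e / 3) e3.
have [dl dl0 hdl] := fc n p p0 (e / 3) e3.
exists (Num.min dl 1); first by rewrite lt_min dl0 ltr01.
move=> q q0; rewrite !lt_min => /andP[q1 q1'] /andP[q2 _].
have h1 := hdl q q0 q1 q2.
have h2 : `|g p - f n p| < e / 3 by apply: hn; rewrite p0 lerDl ler01.
have h3 : `|g q - f n q| < e / 3.
  by apply: hn; rewrite q0 /=; move: q1'; rewrite ltr_norml => /andP[_]; lra.
have -> : g q - g p = (g q - f n q) + (f n q - f n p) - (g p - f n p) by ring.
apply: le_lt_trans (ler_normB _ _) _; have := ler_normD (g q - f n q) (f n q - f n p).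
lra.
Qed.

End Limits.

(** * Probability of the exceptional events *)

Section LocalTime.
Context d (Omega : measurableType d) (R : realType).
Variables (P : probability Omega R) (X : nat -> nat -> {RV P >-> R}).
Hypothesis iid : iid_signs X.

Local Notation bits := (@bits _ _ _ P X).

(** This carries the path estimates over to [P]: [avg] splits on the next step just as the event is
    partitioned by it. *)
Lemma Pr_fair (e : Omega -> nat -> bool) N (Q : pred (seq bool)) :
  steps_in (@measurable _ Omega) e ->
  (forall n s, size s = n -> Pr P [set w | hist (e w) n = s] = 2 ^- n) ->
  Pr P [set w | Q (hist (e w) N)] = pr R N Q.
Proof.
move=> me fair; have sigM := sigma_algebra_measurable Omega.
have mh n s : measurable [set w | hist (e w) n = s].
  rewrite (_ : [set w | _] = [set w | hist (e w) n == s]); last first.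
    by apply/seteqP; split => w /= /eqP.
  exact: (event_hist sigM n (pred1 s) me).
have mQ n : measurable [set w | Q (hist (e w) n)] by exact: (event_hist sigM n Q me).
suff key n i s : size s = i ->
    Pr P ([set w | hist (e w) i = s] `&` [set w | Q (hist (e w) (n + i)%N)])
    = 2 ^- i * avg (fun s => (Q s)%:R) n s.
  have := key N 0%N [::] erefl; rewrite expr0 invr1 mul1r -/(pr R N Q) addn0 => <-.
  by congr Pr; apply/seteqP; split=> w //= -[].
elim: n i s => [|n IH] i s si.
  rewrite add0n /=; case Qs : (Q s).
    rewrite mulr1 -(fair i s si); congr Pr.
    by apply/seteqP; split => w /=; [case|move=> ->].
  rewrite mulr0 (_ : _ `&` _ = set0) /Pr ?measure0//.
  by apply/seteqP; split => w //= -[->]; rewrite Qs.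
rewrite (@Pr_partition _ _ _ P _ (fun w => e w i.+1)); last 2 first.
- exact: measurableI.
- case; first exact: (me i.+1 isT).
  rewrite (_ : [set w | _] = [set w | ~~ e w i.+1]); last first.
    by apply/seteqP; split => w /=; [move=> ->|move=> /negbTE].
  exact: (eventN sigM (me i.+1 isT)).
have half b : Pr P ([set w | hist (e w) i = s] `&` [set w | Q (hist (e w) (n.+1 + i)%N)]
    `&` [set w | e w i.+1 = b]) = 2 ^- i.+1 * avg (fun s => (Q s)%:R) n (b :: s).
  rewrite -IH /= ?si// -addSnnS; congr Pr; apply/seteqP; split => w /=.
      by move=> [[-> Qw] ->].
  by move=> [[-> ->] Qw].
rewrite big_bool /= !half exprSr invfM; lra.
Qed.

Lemma generated_setT S : generated X S setT.
Proof. by have [h0 hC _] := generated_sigma X S; have := hC _ h0; rewrite setD0. Qed.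

Lemma Pr_nested m N (Q : pred (seq bool)) :
  Pr P [set w | Q (hist (nested (bits w) m) N)] = pr R N Q.
Proof.
apply: Pr_fair; first exact: (@nested_in _ _ _ P X m).
move=> n s sn; have sT : generated X (levels m.+1) setT by exact: generated_setT.
by have := Pr_hist_nested iid sn sT; rewrite setIT Pr_setT mulr1.
Qed.

Lemma Pr_bits m N (Q : pred (seq bool)) : Pr P [set w | Q (hist (bits w m) N)] = pr R N Q.
Proof.
apply: (@Pr_fair (fun w => bits w m)).
  by move=> k k0; apply: (@generated_measurable _ _ _ _ X (levels m)); exact: bits_in.
move=> n s sn; have sT : generated X (levels m.+1) setT by exact: generated_setT.
by have := Pr_hist_bits iid sn sT; rewrite setIT Pr_setT mulr1.
Qed.

Definition level (K : R) m : R := K * 2 ^+ (2 * m).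

Definition bad (C K : R) m (w : Omega) : bool :=
  let L := log_bound C (level K m) in let M := horizon (level K m) in
  bad_coarse L M (hist (nested (bits w) m) (M + window L M)) ||
  bad_fine L M (hist (nested (bits w) m.+1) (4 * M)).

Lemma measurable_bad C K m : measurable [set w | bad C K m w].
Proof.
have sigM := sigma_algebra_measurable Omega.
apply: (eventU sigM); exact: (event_hist sigM _ _ (@nested_in _ _ _ P X _)).
Qed.

Lemma Pr_setU_le A B : measurable A -> measurable B -> Pr P (A `|` B) <= Pr P A + Pr P B.
Proof.
move=> mA mB; rewrite -lee_fin EFinD -!PrE//; last exact: measurableU.
exact: measureU2.
Qed.

Lemma Pr_bad C K m : 1 < C -> threshold C <= level K m ->
  Pr P [set w | bad C K m w] <= level K m `^ (1 - C).
Proof.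
move=> C1 h; set L := log_bound C (level K m); set M := horizon (level K m).
have L0 : 0 < L by have := log_bound_ge C1 h; rewrite -/L; lra.
apply: le_trans (bad_mass C1 h); rewrite -/L -/M natrD mulrDl.
set A := [set w | bad_coarse L M (hist (nested (bits w) m) (M + window L M))].
set B := [set w | bad_fine L M (hist (nested (bits w) m.+1) (4 * M))].
have -> : [set w | bad C K m w] = A `|` B.
  by apply/seteqP; split => w /= /orP.
apply: le_trans (Pr_setU_le _ _) _; try exact: measurable_hist_nested.
rewrite /A /B !Pr_nested; apply: lerD; first exact: pr_bad_coarse.
exact: pr_bad_fine.
Qed.

Lemma level_shift K m j : level K (m + j) = level K m * 4 ^+ j.
Proof. by rewrite /level mulnDr exprD !pow2_double mulrA. Qed.

Lemma level_ge K m j : 0 < K -> level K m <= level K (m + j).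
Proof.
move=> K0; rewrite level_shift; apply: ler_peMr; last by rewrite exprn_ege1// ler1n.
by rewrite /level mulr_ge0 ?exprn_ge0 ?ltW.
Qed.

(** The level grows by the factor 4, so the bounds form a geometric series of ratio [4 ^ (1 - C)],
    which is the source of the denominator in the theorem. *)
Lemma tail_bad C K m : 1 < C -> 0 < K -> threshold C <= level K m ->
  let U := [set w | exists j, bad C K (m + j) w] in
  measurable U /\ Pr P U <= level K m `^ (1 - C) / (1 - 4 `^ (1 - C)).
Proof.
move=> C1 K0 h U; set a := level K m `^ (1 - C); set r : R := 4 `^ (1 - C).
pose B j := [set w | bad C K (m + j) w]; pose F n := \big[setU/set0]_(j < n) B j.
have mF n : measurable (F n) by apply: bigsetU_measurable => j _; exact: measurable_bad.
have UE : U = \bigcup_n F n.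
  apply/seteqP; split => w.
    by move=> [j jw]; exists j.+1 => //; rewrite /F -bigcup_mkord; exists j => /=.
  by move=> [n _]; rewrite /F -bigcup_mkord => -[j _ jw]; exists j.
have mU : measurable U by rewrite UE; exact: bigcup_measurable.
have r0 : 0 < r by rewrite powR_gt0.
have r1 : r < 1.
  rewrite /r /powR pnatr_eq0 /= -[ltRHS]expR0 ltr_expR nmulr_rlt0; last by lra.
  by rewrite ln_gt0// ltr1n.
have a0 : 0 <= a by exact: powR_ge0.
have Bj j : Pr P (B j) <= a * r ^+ j.
  apply: le_trans (Pr_bad C1 _) _; first by apply: le_trans h _; exact: level_ge.
  have l0 : 0 <= level K m by rewrite /level mulr_ge0 ?exprn_ge0 ?ltW.
  rewrite level_shift powRM ?exprn_ge0//.
  by rewrite -[4 ^+ j]powR_mulrn// -powRrM [j%:R * _]mulrC powRrM powR_mulrn ?powR_ge0.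
have Fn n : Pr P (F n) <= a * (1 - r ^+ n) / (1 - r).
  elim: n => [|n IH]; first by rewrite /F big_ord0 /Pr measure0 expr0 subrr mulr0 mul0r.
  rewrite /F big_ord_recr /=; apply: le_trans (Pr_setU_le (mF n) (measurable_bad _ _ _)) _.
  apply: le_trans (lerD IH (Bj n)) _; rewrite exprSr.
  have -> : a * (1 - r ^+ n) / (1 - r) + a * r ^+ n = a * (1 - r ^+ n * r) / (1 - r).
    by field; rewrite subr_eq0 gt_eqF.
  exact: lexx.
split=> //; rewrite UE.
have cF : Pr P (F n) @[n --> \oo] --> Pr P (\bigcup_n F n).
  apply: cvg_Pr => //; apply/nondecreasing_seqP => n; rewrite subsetEset /F big_ord_recr /=.
  exact: subsetUl.
apply: ler_cvg_to cF (@cvg_cst _ (a / (1 - r)) _ \oo _) _; exists 0%N => // n _.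
apply: le_trans (Fn n) _; rewrite ler_pM2r ?invr_gt0 ?subr_gt0//.
by rewrite -[leRHS]mulr1 ler_wpM2l// gerBl exprn_ge0// ltW.
Qed.

End LocalTime.

(** * Convergence along a good path *)

Section Convergence.
Context d (Omega : measurableType d) (R : realType).
Variables (P : probability Omega R) (X : nat -> nat -> {RV P >-> R}).

Local Notation bits := (@bits _ _ _ P X).

(* [walk_local_time] computed from the steps regarded as signs; the two agree
   outside a negligible set. *)
Definition sign_local_time (m : nat) (w : Omega) (p : R * R) : R :=
  interpolation (fun k z => 2 ^- m * (occupation z (hist (nested (bits w) m) k))%:R)
    (p.1 * 2 ^+ (2 * m)) (p.2 * 2 ^+ m).

Lemma sign_local_timeE w m p :
  (forall m k, (1 <= k)%N -> X m k w = 1 \/ X m k w = - 1) ->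
  (forall m k, exists i, (k < blocks (hist (bits w m) i))%N) ->
  walk_local_time (sample X w) m p = sign_local_time m w p.
Proof.
move=> h1 h2; rewrite walk_local_timeE /sign_local_time; congr interpolation.
apply/funext => k; apply/funext => z; rewrite /grid_local_time.
by rewrite (@visits_occupation _ (sample X w)).
Qed.

Lemma truncn_mul4 (s : R) : 0 <= s ->
  (4 * Num.truncn s <= Num.truncn (4 * s) <= 4 * Num.truncn s + 3)%N.
Proof.
move=> s0; have s40 : 0 <= 4 * s by rewrite mulr_ge0.
have /andP[h1 h2] := truncn_itv s0; have /andP[h3 h4] := truncn_itv s40.
apply/andP; split.
  rewrite -ltnS -(ltr_nat R) natrM; apply: le_lt_trans h4; lra.
rewrite -ltnS -(ltr_nat R); apply: le_lt_trans h3 _.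
rewrite (_ : (4 * Num.truncn s + 3).+1 = 4 * (Num.truncn s).+1)%N; last by lia.
by rewrite natrM; lra.
Qed.

Lemma floor_mul2 (z : R) :
  2 * Num.floor z <= Num.floor (2 * z) <= 2 * Num.floor z + 1.
Proof.
have /andP[h1 h2] := floor_itv z; have /andP[h3 h4] := floor_itv (2 * z).
apply/andP; split.
  rewrite -ltzD1 -(ltr_int R); apply: le_lt_trans h4; rewrite intrM; lra.
rewrite -ltzD1 -(ltr_int R); apply: le_lt_trans h3 _; rewrite !intrD intrM.
by move: h2; rewrite intrD; lra.
Qed.

Lemma level_step C K m w p : 1 < C -> threshold C <= level K m ->
  ~~ bad X C K m w -> strip K p ->
  `|sign_local_time m.+1 w p - sign_local_time m w p| <= level_error C K m.
Proof.
move=> C1 h nbad; case: p => t y /= [/= tK _]; move: tK; rewrite in_itv /= => /andP[t0 tK].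
move: nbad; rewrite /bad; set L := log_bound C (level K m); set M := horizon (level K m).
rewrite negb_or => /andP[nbc nbf].
have L0 : 0 < L by have := log_bound_ge C1 h; rewrite -/L; lra.
have M0 : (0 < M)%N by [].
rewrite /sign_local_time /=; set s := t * 2 ^+ (2 * m); set z := y * 2 ^+ m.
have s0 : 0 <= s by rewrite mulr_ge0 ?exprn_ge0.
have -> : t * 2 ^+ (2 * m.+1) = 4 * s.
  by rewrite /s mulnS exprD; move: (2 ^+ (2 * m)) => q; ring.
have -> : y * 2 ^+ m.+1 = 2 * z by rewrite /z exprS; ring.
have s40 : 0 <= 4 * s by rewrite mulr_ge0.
have sM : (Num.truncn s < M)%N.
  by rewrite /M /horizon ltnS; apply: le_truncn; rewrite /s /level ler_wpM2r ?exprn_ge0.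
have /andP[t1 t2] := truncn_mul4 s0; have /andP[z1 z2] := floor_mul2 z.
have p0 : 0 < 2 ^- m :> R by rewrite invr_gt0 exprn_gt0.
have err : 2 ^- m * step_error L M <= level_error C K m.
  rewrite /level_error (mulrC (13 / 2)) -(mulrA (2 ^- m)); apply: (ler_wpM2l (ltW p0)).
  exact: (step_error_le C1 h).
(* The first use reduces the fine value to the corners of its cell, the second one the coarse value
   to the corners of its own. *)
apply: interpolation_near => // i y' /andP[i1 i2] /andP[y1 y2].
rewrite distrC; apply: interpolation_near => // k x /andP[k1 k2] /andP[x1 x2].
rewrite distrC; apply: le_trans err.
have -> : 2 ^- m.+1 * (occupation y' (hist (nested (bits w) m.+1) i))%:R
   - 2 ^- m * (occupation x (hist (nested (bits w) m) k))%:R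
   = 2 ^- m * ((occupation y' (hist (nested (bits w) m.+1) i))%:R / 2
      - (occupation x (hist (nested (bits w) m) k))%:R) :> R.
  by rewrite exprSr invfM; ring.
rewrite normrM (gtr0_norm p0); apply: (ler_wpM2l (ltW p0)).
have [a1 a2 a3 a4 a5] : [/\ (k <= M)%N, (i <= 4 * M)%N, (i <= 4 * k + 4)%N,
    (4 * k <= i + 4)%N & (absz (y' - 2 * x)%R <= 2)%N].
  clear nbc nbf; split; lia.
exact: (one_step L0 M0 a1 a2 a3 a4 a5 nbc nbf).
Qed.

Lemma level_error_decrease (C K : R) m : 1 < C -> 0 < K -> threshold C <= level K m ->
  forall j, (m <= j)%N -> level_error C K j.+1 <= 3 / 4 * level_error C K j.
Proof.
move=> C1 K0 h j mj; apply: level_error_half => //.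
by apply: le_trans h _; rewrite -(subnKC mj); exact: level_ge.
Qed.

Lemma level_limit C K m w : 1 < C -> 0 < K -> threshold C <= level K m ->
  (forall j, (m <= j)%N -> ~~ bad X C K j w) ->
  forall p, strip K p -> cvgn (fun j => sign_local_time j w p) /\
    forall j, (m <= j)%N ->
    `|limn (fun j => sign_local_time j w p) - sign_local_time j w p| <= 4 * level_error C K j.
Proof.
move=> C1 K0 h nbad p Kp; apply: geometric_cvg (level_error_decrease C1 K0 h) => j mj.
apply: (level_step C1) (nbad j mj) Kp.
by apply: le_trans h _; rewrite -(subnKC mj); exact: level_ge.
Qed.

Lemma sign_local_time_continuous m w : jointly_continuous (sign_local_time m w).
Proof.
move=> p p0 e e0; rewrite /sign_local_time.
set f := interpolation _; set a : R := 2 ^+ (2 * m); set b : R := 2 ^+ m.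
have a0 : 0 < a by rewrite exprn_gt0.
have b0 : 0 < b by rewrite exprn_gt0.
have pa0 : 0 <= p.1 * a by rewrite mulr_ge0// ltW.
have [c c0 hc] := interpolation_locally_lipschitz
  (fun k z => 2 ^- m * (occupation z (hist (nested (bits w) m) k))%:R) (p.2 * b) pa0.
pose dl := Num.min (Num.min a^-1 b^-1) (e / (2 * (c + 1) * (a + b))).
have c10 : 0 < c + 1 by rewrite ltr_wpDl.
have ab0 : 0 < a + b by rewrite addr_gt0.
have c1 : 0 < 2 * (c + 1) * (a + b) by rewrite !mulr_gt0.
exists dl; first by rewrite !lt_min !invr_gt0 a0 b0 divr_gt0.
move=> q q0; rewrite !lt_min => /andP[/andP[h1 _] h2] /andP[/andP[_ h3] h4].
have n1 : `|q.1 * a - p.1 * a| = `|q.1 - p.1| * a by rewrite -mulrBl normrM (gtr0_norm a0).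
have n2 : `|q.2 * b - p.2 * b| = `|q.2 - p.2| * b by rewrite -mulrBl normrM (gtr0_norm b0).
have qa0 : 0 <= q.1 * a by rewrite mulr_ge0// ltW.
have := hc (q.1 * a) (q.2 * b) qa0; rewrite n1 n2 -!ltr_pdivlMr// !mul1r => /(_ h1 h3) le.
apply: le_lt_trans le _; set dt := e / _ in h2 h4.
have dt0 : 0 < dt by rewrite divr_gt0.
have hh : `|q.1 - p.1| * a + `|q.2 - p.2| * b <= dt * (a + b).
  by rewrite mulrDr; apply: lerD; apply: ler_wpM2r; exact: ltW.
apply: le_lt_trans (ler_wpM2l c0 hh) _.
have eE : e = 2 * (c + 1) * (dt * (a + b)).
  by rewrite (mulrC dt) mulrA /dt mulrCA divff ?mulr1// gt_eqF.
rewrite [ltRHS]eE; have u0 : 0 < dt * (a + b) by rewrite mulr_gt0.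
rewrite ltr_pM2r//; lra.
Qed.

(** At a fixed point the value depends on finitely many steps, so every preimage is an event of a
    finite path. In [F], [drop] removes the newest steps to recover the shorter histories. *)
Lemma measurable_sign_local_time m p : 0 <= p.1 ->
  measurable_fun setT (fun w => sign_local_time m w p).
Proof.
move=> p0; set k := Num.truncn (p.1 * 2 ^+ (2 * m)).
pose F (s : seq bool) : R :=
  interpolation (fun k' z => 2 ^- m * (occupation z (drop (k.+1 - k') s))%:R)
    (p.1 * 2 ^+ (2 * m)) (p.2 * 2 ^+ m).
have FE w : sign_local_time m w p = F (hist (nested (bits w) m) k.+1).
  rewrite /sign_local_time /F /interpolation -/k subnn subSnn /= drop0.
  by [].
move=> _ B mB; rewrite setTI.
rewrite (_ : _ @^-1` B = [set w | `[< B (F (hist (nested (bits w) m) k.+1)) >]]); last first.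
  by apply/seteqP; split => w; rewrite /preimage /= FE => /asboolP.
exact: (measurable_hist_nested X m k.+1 (fun s => `[< B (F s) >])).
Qed.

End Convergence.

(** * Null sets *)

Section NullSets.
Context d (Omega : measurableType d) (R : realType).
Variables (P : probability Omega R) (X : nat -> nat -> {RV P >-> R}).
Hypothesis iid : iid_signs X.

Local Notation bits := (@bits _ _ _ P X).

Lemma negligible_small (A : set Omega) :
  (forall e : R, 0 < e -> exists B, [/\ measurable B, A `<=` B & Pr P B <= e]) ->
  P.-negligible A.
Proof.
move=> h; have h' (n : nat) : exists B, [/\ measurable B, A `<=` B & Pr P B <= n.+1%:R^-1].
  by apply: h; rewrite invr_gt0.
have [B hB] := choice h'.
have mBn n : measurable (B n) by have [] := hB n.
have mB : measurable (\bigcap_n B n) by exact: bigcapT_measurable.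
exists (\bigcap_n B n); split=> //; last by move=> w Aw n _; have [_ + _] := hB n; exact.
rewrite (PrE P mB); congr (_%:E); apply/eqP; rewrite eq_le fine_ge0 ?measure_ge0// andbT.
rewrite leNgt; apply/negP => Pr0; set p := Pr P (\bigcap_n B n) in Pr0 *.
have [_ _ hn] := hB (Num.truncn p^-1).
have le : p <= Pr P (B (Num.truncn p^-1)) by apply: le_Pr => //; exact: bigcap_inf.
have := le_trans le hn; rewrite leNgt => /negP; apply.
have p1 : 0 <= p^-1 by rewrite invr_ge0 ltW.
by have /andP[_] := truncn_itv p1; rewrite invf_plt ?posrE.
Qed.

Lemma sign_negligible m k : (1 <= k)%N -> P.-negligible [set w | ~ (X m k w = 1 \/ X m k w = - 1)].
Proof.
move=> k1; have [_ /(_ m k k1)[p1 p2]] := iid.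
have mX (B : set R) : measurable B -> measurable (X m k @^-1` B).
  by move=> mB; rewrite -[X in measurable X]setTI; exact: measurable_funP.
have mA : measurable (X m k @^-1` [set 1] `|` X m k @^-1` [set -1]).
  by apply: measurableU; apply: mX; exact: measurable_set1.
exists (~` (X m k @^-1` [set 1] `|` X m k @^-1` [set -1])); split=> //.
- exact: measurableC.
- rewrite probability_setC// measureU; [|exact: mX|exact: mX|].
    rewrite [X in (_ - (X + _))%E]p1 [X in (_ - (_ + X))%E]p2 -EFinD.
    have -> : 2^-1 + 2^-1 = 1 :> R by field.
    by rewrite subrr.
  by apply/seteqP; split => w //= -[-> h]; clear p1 p2; lra.
Qed.

(** At most [k] completed blocks at time [4 j] would be a large deviation of the block count from
    [j], of probability at most [2 exp (- l)]. *)
Lemma blocks_negligible m k :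
  P.-negligible [set w | ~ exists i, (k < blocks (hist (bits w m) i))%N].
Proof.
apply: negligible_small => e e0.
(* With this [j] the defect [j - k] exceeds [(l + j) / 2 + 1], hence also [sqrt (l j) + 1]. *)
pose l := (Num.truncn (2 / e)).+1; pose j := (l + 2 * k + 3)%N.
have l0 : 0 < l%:R :> R by [].
have j0 : (0 < j)%N by rewrite /j addn3.
pose Q s := bad_blocks l%:R (tilt l%:R (j%:R / 2) : R) s ||
            bad_blocks l%:R (- tilt l%:R (j%:R / 2) : R) s.
exists [set w | Q (hist (bits w m) (4 * j))]; split.
- apply: (@generated_measurable _ _ _ _ X (levels m)).
  exact: (event_hist (generated_sigma X _) _ Q (@bits_in _ _ _ P X m)).
- move=> w /= nk; apply/negPn/negP; rewrite /Q negb_or => /andP[q1 q2].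
  apply: nk; exists (4 * j)%N; rewrite ltnNge; apply/negP; rewrite -(ler_nat R) => bk.
  have := blocks_le_sqrt l0 j0 (leqnn j) q1 q2.
  have sq : Num.sqrt (l%:R * j%:R) <= (l%:R + j%:R) / 2 :> R.
    by apply: sqrt_le; [rewrite divr_ge0|rewrite expr2; have := sqr_ge0 (l%:R - j%:R : R); rewrite expr2; lra].
  rewrite ler_norml => /andP[+ _]; have jE : j%:R = l%:R + 2 * k%:R + 3 :> R.
    by rewrite /j (natrD _ (l + _)) (natrD _ l) natrM.
  by move: sq bk jE; clear; lra.
- rewrite (@Pr_bits _ _ _ P X iid m); set u := tilt _ _ in Q *.
  apply: (le_trans (@pr_or R (4 * j) (bad_blocks l%:R u) (bad_blocks l%:R (- u)))).
  apply: le_trans (lerD (@pr_block R l%:R (4 * j) predT u) (@pr_block R l%:R (4 * j) predT (- u))) _.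
  have h1 := expR_ge1Dx (l%:R : R).
  have e2 : 0 <= 2 / e by rewrite divr_ge0// ltW.
  have /andP[_ h2] := truncn_itv e2; rewrite -/l in h2.
  rewrite expRN -mulr2n -[_ *+ 2]mulr_natl -ler_pdivlMl// mulrC.
  have h3 : 2 / e < expR l%:R by lra.
  have pe : 0 < expR (l%:R : R) by exact: expR_gt0.
  rewrite -[leRHS]invrK lef_pV2 ?posrE ?invr_gt0 ?divr_gt0//.
  by rewrite invfM invrK mulrC ltW.
Qed.

(** A Borel-Cantelli argument: for [C = 2] the bound of [tail_bad] is 4/3 divided by the level,
    which tends to 0. *)
Lemma bad_negligible (K : R) : 1 <= K ->
  P.-negligible [set w | ~ exists M, forall m, (M <= m)%N -> ~~ bad X 2 K m w].
Proof.
move=> K1; apply: negligible_small => e e0.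
have C1 : 1 < 2 :> R by lra.
have K0 : 0 < K by lra.
pose m := (Num.truncn (Num.max (threshold 2) (2 / e))).+1.
have big : Num.max (threshold 2) (2 / e) <= level K m.
  apply: (@le_trans _ _ (m%:R)).
    have h : 0 <= Num.max (threshold 2) (2 / e) by rewrite le_max divr_ge0 ?orbT// ltW.
    by have /andP[_ /ltW] := truncn_itv h.
  rewrite /level pow2_double; apply: (@le_trans _ _ (4 ^+ m)).
    by rewrite -natrX ler_nat; exact: ltnW (ltn_expl _ _).
  by rewrite ler_peMl// exprn_ge0.
move: big; rewrite ge_max => /andP[b1 b2].
have [mU leU] := tail_bad iid C1 K0 b1.
exists [set w | exists j, bad X 2 K (m + j) w]; split=> //.
  move=> w /= nh; apply: contrapT => nj; apply: nh; exists m => j mj.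
  by apply/negP => bj; apply: nj; exists (j - m)%N; rewrite subnKC.
apply: le_trans leU _.
have -> : 1 - 2 = -1 :> R by ring.
have lv : 0 < level K m by apply: lt_le_trans b2; rewrite divr_gt0.
rewrite (powR_inv1 (ltW lv)) powR_inv1//.
have -> : 1 - 4^-1 = 3 / 4 :> R by field.
rewrite -[leRHS]invrK -invfM lef_pV2 ?posrE ?invr_gt0 ?mulr_gt0//.
have : e^-1 <= level K m / 2 by rewrite ler_pdivlMr// mulrC.
by lra.
Qed.

(** A single null set serves all strips, since each is contained in one of integer length. *)
Lemma good_set : exists N : set Omega, [/\ measurable N, P N = 0 &
  forall w, ~ N w -> [/\ forall m k, (1 <= k)%N -> X m k w = 1 \/ X m k w = - 1,
    forall m k, exists i, (k < blocks (hist (bits w m) i))%N &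
    forall K : nat, exists M, forall m, (M <= m)%N -> ~~ bad X 2 (K.+1%:R) m w]].
Proof.
have n1 : P.-negligible (\bigcup_m \bigcup_k [set w | ~ (X m k.+1 w = 1 \/ X m k.+1 w = - 1)]).
  by apply: negligible_bigcup => m; apply: negligible_bigcup => k; exact: sign_negligible.
have n2 : P.-negligible (\bigcup_m \bigcup_k
    [set w | ~ exists i, (k < blocks (hist (bits w m) i))%N]).
  by apply: negligible_bigcup => m; apply: negligible_bigcup => k; exact: blocks_negligible.
have n3 : P.-negligible (\bigcup_K
    [set w | ~ exists M, forall m, (M <= m)%N -> ~~ bad X 2 (K.+1%:R) m w]).
  by apply: negligible_bigcup => K; apply: bad_negligible; rewrite ler1n.
have [N [mN N0 NS]] := negligibleU n1 (negligibleU n2 n3).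
exists N; split=> // w nN; split.
- move=> m [//|k] _; apply: contrapT => h; apply/nN/NS; left.
  by exists m => //; exists k.
- move=> m k; apply: contrapT => h; apply/nN/NS; right; left.
  by exists m => //; exists k.
- by move=> K; apply: contrapT => h; apply/nN/NS; right; right; exists K.
Qed.

End NullSets.

(** * The limit and its deviation from the walks *)

Section LimitProcess.
Context d (Omega : measurableType d) (R : realType).
Variables (P : probability Omega R) (X : nat -> nat -> {RV P >-> R}).
Hypothesis iid : iid_signs X.
Variable N : set Omega.
Hypotheses (mN : measurable N) (N0 : P N = 0).
Hypothesis signs : forall w, ~ N w -> forall m k, (1 <= k)%N -> X m k w = 1 \/ X m k w = - 1.
Hypothesis unbounded :
  forall w, ~ N w -> forall m k, exists i, (k < blocks (hist (bits X w m) i))%N.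
Hypothesis eventually_good : forall w, ~ N w ->
  forall K : nat, exists M, forall m, (M <= m)%N -> ~~ bad X 2 (K.+1%:R : R) m w.

(* On the null set N any value will do; with this one the supremum in
   [deviation_event] is infinite there, hence the event contains N. *)
Definition limit_time (w : Omega) (p : R * R) : R :=
  if `[< N w >] then p.2 else limn (fun m => sign_local_time X m w p).

Lemma local_time_sign w m p : ~ N w ->
  walk_local_time (sample X w) m p = sign_local_time X m w p.
Proof. by move=> nN; apply: sign_local_timeE; [exact: signs|exact: unbounded]. Qed.

Lemma limit_uniform w K e : ~ N w -> 0 < e -> exists n, forall m, (n <= m)%N ->
  forall p, strip K p -> `|sign_local_time X m w p - limit_time w p| < e.
Proof.
move=> nN e0; have [M hM] := eventually_good nN (Num.truncn K).
set K' : R := (Num.truncn K).+1%:R in hM.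
have K0 : 0 < K' by [].
have KK' : K <= K' by rewrite ltW// truncnS_gt.
have C1 : 1 < 2 :> R by lra.
pose m0 := maxn M (Num.truncn (threshold (2 : R))).+1.
have th : threshold 2 <= level K' m0.
  have h : 0 <= threshold (2 : R) by rewrite addr_ge0 ?expR_ge0// mulr_ge0 ?sqr_ge0.
  have /andP[_ /ltW h1] := truncn_itv h; apply: (le_trans h1).
  apply: (@le_trans _ _ (m0%:R)); first by rewrite ler_nat leq_maxr.
  rewrite /level pow2_double; apply: (@le_trans _ _ (4 ^+ m0)).
    by rewrite -natrX ler_nat; exact: ltnW (ltn_expl _ _).
  by rewrite ler_peMl ?exprn_ge0// ler1n.
have nb j : (m0 <= j)%N -> ~~ bad X 2 K' j w.
  by move=> mj; apply: hM; apply: leq_trans mj; exact: leq_maxl.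
have dec := level_error_decrease C1 K0 th.
have e4 : 0 < e / 4 by rewrite divr_gt0.
have lim := level_limit C1 K0 th nb.
have pos j : (m0 <= j)%N -> 0 <= level_error 2 K' j.
  move=> mj; have z : strip K' (0, 0 : R) by split=> //=; rewrite in_itv /= lexx ltW.
  by have [_ /(_ j mj)] := lim _ z; have := normr_ge0 (limn (fun j => sign_local_time X j w (0, 0)) - sign_local_time X j w (0, 0)); lra.
have [n mn hn] := geometric_small e4 pos dec.
exists n => m nm p Kp; have Kp' : strip K' p.
  by case: Kp => /= h _; split=> //=; move: h; rewrite !in_itv /= => /andP[-> /le_trans]; exact.
rewrite /limit_time asboolF// distrC; have [_ /(_ m (leq_trans mn nm)) h] := lim _ Kp'.
by apply: le_lt_trans h _; have := hn m nm; lra.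
Qed.

Lemma limit_pointwise w p : ~ N w -> 0 <= p.1 ->
  sign_local_time X m w p @[m --> \oo] --> limit_time w p.
Proof.
move=> nN p0; apply/cvgrPdist_lt => e e0; have [n hn] := limit_uniform p.1 nN e0.
exists n => // m /= nm; rewrite distrC; apply: hn => //.
by split=> //=; rewrite in_itv /= p0 lexx.
Qed.

Lemma limit_continuous w : ~ N w -> jointly_continuous (limit_time w).
Proof.
move=> nN; apply: (jointly_continuous_uniform_limit (fun m => @sign_local_time_continuous _ _ _ _ X m w)).
move=> K e e0; have [n hn] := limit_uniform K nN e0.
exists n => p p0; rewrite distrC; apply: hn => //; by split=> //=; rewrite in_itv /=.
Qed.

Lemma limit_measurable p : 0 <= p.1 -> measurable_fun setT (limit_time ^~ p).
Proof.
move=> p0; have mb : measurable_fun setT (fun w => `[< N w >]).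
  apply: (@measurable_fun_bool _ _ _ _ true); rewrite setTI.
  rewrite (_ : _ @^-1` _ = N)//; by apply/seteqP; split => w /= /asboolP.
apply: (@measurable_realfun.measurable_fun_cvg _ _ _ _
   (fun m w => if `[< N w >] then p.2 else sign_local_time X m w p)).
  move=> m; apply: measurable_fun_ifT; [exact: mb|exact: measurable_cst|].
  exact: measurable_sign_local_time.
move=> w _; case: (pselect (N w)) => Nw.
  by rewrite /limit_time asboolT//; exact: cvg_cst.
by have := limit_pointwise Nw p0; rewrite /limit_time asboolF.
Qed.

Lemma ae_off_N (Q : Omega -> Prop) : (forall w, ~ N w -> Q w) -> {ae P, forall w, Q w}.
Proof.
move=> h; exists N; split=> // w /= nQ; apply: contrapT => nN; apply: nQ; exact: h.
Qed.

(** Rational points clamped to the strip form a countable dense subset of it; reducing the supremum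
    to them makes the deviation event measurable. *)
Definition rational_point (K : R) (a b : rat) : R * R :=
  (Num.min K (Num.max 0 (ratr a)), ratr b).

Lemma rational_point_strip K a b : 0 < K -> strip K (rational_point K a b).
Proof.
move=> K0; split=> //=; rewrite in_itv /= le_min ge_min lexx /= andbT le_max lexx /=.
by rewrite ltW.
Qed.

Lemma rational_point_dense K p dl : strip K p -> 0 < dl -> exists a b,
  `|(rational_point K a b).1 - p.1| < dl /\ `|(rational_point K a b).2 - p.2| < dl.
Proof.
case: p => t y [/=]; rewrite in_itv /= => /andP[t0 tK] _ dl0.
have t1 : t - dl < t + dl by lra.
have y1 : y - dl < y + dl by lra.
have [a ha] := rat_in_itvoo t1; have [b hb] := rat_in_itvoo y1.
exists a, b; rewrite /rational_point /=; split.
  move: ha; rewrite in_itv /= ltr_norml => /andP[h1 h2].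
  by case: (leP 0 (ratr a)) => h3; case: (leP K _) => h4; apply/andP; split; lra.
by move: hb; rewrite in_itv /= ltr_norml => /andP[h1 h2]; apply/andP; split; lra.
Qed.

(** At the point [(0, r)] every walk has local time 0, while [limit_time] takes the value [r] on
    [N]. *)
Lemma deviation_null m K r w : 0 < K -> N w ->
  deviation_event X limit_time m K r w.
Proof.
move=> K0 Nw; rewrite /deviation_event /=.
apply: (@le_trans _ _ (`|limit_time w (0, r) - walk_local_time (sample X w) m (0, r)|%:E)%E).
  rewrite lee_fin /limit_time asboolT// walk_local_timeE /= mul0r interpolation_time0.
    by rewrite subr0; exact: ler_norm.
  by move=> j; rewrite /grid_local_time /visits mulr0.
apply: ereal_sup_ubound; exists (0, r) => //; split=> //=.
by rewrite in_itv /= lexx ltW.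
Qed.

(** The supremum need not be attained, hence the margins [1 / (i + 1)]; continuity of both functions
    moves a nearly optimal point to a rational one. *)
Lemma deviation_off_null m K r w : 0 < K -> ~ N w ->
  deviation_event X limit_time m K r w <->
  forall i : nat, exists a b, r - i.+1%:R^-1 <
    `|limit_time w (rational_point K a b) - sign_local_time X m w (rational_point K a b)|.
Proof.
move=> K0 nN; rewrite /deviation_event /=; split=> h.
  move=> i; have lt : ((r - i.+1%:R^-1)%:E < ereal_sup
    [set `|limit_time w p - walk_local_time (sample X w) m p|%:E | p in strip K])%E.
    by apply: lt_le_trans h; rewrite lte_fin gtrBl invr_gt0.
  have [_ [p Kp <-]] := ereal_sup_gt lt; rewrite lte_fin local_time_sign// => gap.
  (* Half of the surplus, because each of the two functions changes by less than [e]. *)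
  set g := `|_ - _| in gap; pose e := (g - (r - i.+1%:R^-1)) / 2.
  have e0 : 0 < e by rewrite divr_gt0// subr_gt0.
  have p0 : 0 <= p.1 by case: Kp => /=; rewrite in_itv /= => /andP[].
  have [d1 d10 h1] := limit_continuous nN p0 e0.
  have [d2 d20 h2] := @sign_local_time_continuous _ _ _ _ X m w p p0 e e0.
  have d0 : 0 < Num.min d1 d2 by rewrite lt_min d10.
  have [a [b []]] := rational_point_dense Kp d0; rewrite !lt_min => /andP[a1 a2] /andP[b1 b2].
  exists a, b; set q := rational_point K a b in a1 a2 b1 b2 *.
  have q0 : 0 <= q.1 by case: (rational_point_strip a b K0) => /=; rewrite in_itv /= => /andP[].
  have := h1 q q0 a1 b1; have := h2 q q0 a2 b2.
  have ge : r - i.+1%:R^-1 = g - 2 * e by rewrite /e; field.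
  rewrite ge /g; set u := limit_time w p; set v := sign_local_time X m w p.
  set u' := limit_time w q; set v' := sign_local_time X m w q => k2 k1.
  have -> : `|u - v| = `|(u' - v') - ((u' - u) - (v' - v))| by congr `|_|; ring.
  have := ler_normB (u' - v') ((u' - u) - (v' - v)); have := ler_normB (u' - u) (v' - v).
  by move: (`|u' - v'|) (`|u' - u - (v' - v)|) (`|u' - v' - (u' - u - (v' - v))|) k1 k2; clear; move=> x y z; lra.
set S := [set _ | p in _].
have ub i : exists2 x : R, (x%:E <= ereal_sup S)%E & r - i.+1%:R^-1 < x.
  have [a [b hab]] := h i; exists `|limit_time w (rational_point K a b) - sign_local_time X m w (rational_point K a b)| => //.
  apply: ereal_sup_ubound; exists (rational_point K a b); first exact: rational_point_strip.
  by rewrite local_time_sign.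
move: (ereal_sup S) ub => [s| |] ub; rewrite ?leey//; last first.
  by have [x] := ub 0%N; rewrite leeNy_eq.
rewrite lee_fin leNgt; apply/negP => sr.
have rs0 : 0 <= (r - s)^-1 by rewrite invr_ge0 subr_ge0 ltW.
have [x] := ub (Num.truncn (r - s)^-1); rewrite lee_fin => xs gt.
have lt : (Num.truncn (r - s)^-1).+1%:R^-1 < r - s.
  by rewrite invf_plt ?posrE ?subr_gt0//; have /andP[] := truncn_itv rs0.
by have := lt_le_trans gt xs; rewrite ltrBlDr -ltrBlDl => /(lt_trans lt); rewrite ltxx.
Qed.

Lemma measurable_deviation m K r : 0 < K ->
  measurable (deviation_event X limit_time m K r).
Proof.
move=> K0; pose A i a b := [set w | r - i.+1%:R^-1 <
  `|limit_time w (rational_point K a b) - sign_local_time X m w (rational_point K a b)|].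
have -> : deviation_event X limit_time m K r =
    N `|` (~` N `&` \bigcap_i \bigcup_a \bigcup_b A i a b).
  apply/seteqP; split => w.
    move=> Ew; case: (pselect (N w)) => Nw; [by left|right; split=> // i _].
    by have [a [b hab]] := (deviation_off_null m r K0 Nw).1 Ew i; exists a => //; exists b.
  case=> [Nw|[Nw h]]; first exact: deviation_null.
  apply/(deviation_off_null m r K0 Nw) => i; have [a _ [b _ hab]] := h i I.
  by exists a, b.
apply: measurableU => //; apply: measurableI; first exact: measurableC.
apply: bigcapT_measurable => i; apply: bigcupT_measurable_rat => a.
apply: bigcupT_measurable_rat => b.
have p0 : 0 <= (rational_point K a b).1.
  by case: (rational_point_strip a b K0) => /=; rewrite in_itv /= => /andP[].
set q := rational_point K a b in p0 *.
have mf : measurable_fun setT (fun w => `|limit_time w q - sign_local_time X m w q|).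
  apply: measurableT_comp; first exact: measurable_realfun.normr_measurable.
  apply: measurable_realfun.measurable_funB; first exact: limit_measurable.
  exact: measurable_sign_local_time.
have := mf measurableT `]r - i.+1%:R^-1, +oo[%classic (measurable_itv _).
rewrite setTI; congr measurable; apply/seteqP; split => w; by rewrite /A /= in_itv /= andbT.
Qed.

(** Off the exceptional sets all deviations are at most [4 * level_error C K m]. Their supremum may
    equal this number, so the strict inequality is what keeps it below [r]. *)
Lemma deviation_bound C K m r : 1 < C -> 0 < K -> threshold C <= level K m ->
  4 * level_error C K m < r ->
  (P (deviation_event X limit_time m K r) <=
     (level K m `^ (1 - C) / (1 - 4 `^ (1 - C)))%:E)%E.
Proof.
move=> C1 K0 h rr; have [mU leU] := tail_bad iid C1 K0 h.
set U := [set w | exists j, bad X C K (m + j) w] in mU leU.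
have sub : deviation_event X limit_time m K r `<=` N `|` U.
  move=> w Ew; case: (pselect (N w)) => Nw; [by left|right].
  apply: contrapT => nU; move: Ew; rewrite /deviation_event /= leNgt => /negP; apply.
  apply: (@le_lt_trans _ _ (4 * level_error C K m)%:E); last by rewrite lte_fin.
  apply: ge_ereal_sup => _ [p Kp <-]; rewrite lee_fin local_time_sign// /limit_time asboolF//.
  have nb j : (m <= j)%N -> ~~ bad X C K j w.
    by move=> mj; apply/negP => bj; apply: nU; exists (j - m)%N; rewrite subnKC.
  by have [_] := level_limit C1 K0 h nb Kp; apply.
apply: (@le_trans _ _ (P (N `|` U))).
  apply: le_measure => //; rewrite inE; [exact: measurable_deviation|exact: measurableU].
apply: (@le_trans _ _ (P N + P U)%E); first exact: measureU2.
by rewrite N0 add0e PrE// lee_fin.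
Qed.

End LimitProcess.

Theorem theorem3 (R : realType) :
  exists N6 : R -> R,
  forall (d : measure_display) (Omega : measurableType d)
    (P : probability Omega R) (X : nat -> nat -> {RV P >-> R}),
  iid_signs X ->
  exists L : Omega -> R * R -> R,
  [/\ forall p : R * R, 0 <= p.1 -> measurable_fun setT (L ^~ p),
      forall K : R, 0 < K ->
        {ae P, forall w,
          {uniform strip K,
            (fun m => walk_local_time (sample X w) m) @ \oo --> L w}},
      {ae P, forall w, {within [set p : R * R | 0 <= p.1], continuous (L w)}},
      forall W : Omega -> R -> R, limit_motion X W -> local_time_of X W L &
      forall C : R, 1 < C ->
      forall (K : R) (m : nat), 0 < K -> (1 <= m)%N ->
        N6 C <= K * 2 ^+ (2 * m) ->
        let E := deviation_event X L m K
          (79 * C * max1 K `^ 4^-1 * max1 (ln K) `^ (3 / 4)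
             * m%:R `^ (3 / 4) * 2 `^ (- (m%:R / 2))) in
        measurable E /\
        (P E <= (15 / (1 - 4 `^ (1 - C)) * (K * 2 ^+ (2 * m)) `^ (1 - C))%:E)%E].
Proof.
exists (@threshold R) => d Omega P X iid.
have [N [mN N0 good]] := good_set iid.
have signs w : ~ N w -> forall m k, (1 <= k)%N -> X m k w = 1 \/ X m k w = - 1 by case/good.
have unbounded w : ~ N w -> forall m k, exists i, (k < blocks (hist (bits X w m) i))%N.
  by case/good.
have egood w : ~ N w -> forall K : nat, exists M, forall m, (M <= m)%N ->
  ~~ bad X 2 (K.+1%:R : R) m w by case/good.
exists (limit_time X N); split.
- by move=> p p0; exact: limit_measurable.
- move=> K K0; apply: (ae_off_N mN N0) => w Nw; apply: uniform_cvgP => e e0.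
  have [n hn] := limit_uniform egood K Nw e0; exists n => m nm p Kp.
  by rewrite (local_time_sign signs unbounded)//; exact: hn.
- apply: (ae_off_N mN N0) => w Nw; apply: within_continuous; exact: limit_continuous.
- move=> W hW; split=> //; apply: (ae_off_N mN N0) => w Nw p p0.
  under eq_fun do rewrite (local_time_sign signs unbounded)//.
  exact: limit_pointwise.
- move=> C C1 K m K0 m1 h; split; first exact: measurable_deviation.
  apply: le_trans (deviation_bound iid mN N0 signs unbounded egood C1 K0 h (total_error_lt C1 K0 m1 h)) _.
  have r1 : 0 < 1 - 4 `^ (1 - C) :> R.
    rewrite subr_gt0 /powR pnatr_eq0 /= -[ltRHS]expR0 ltr_expR nmulr_rlt0; last by lra.
    by rewrite ln_gt0// ltr1n.
  (* [deviation_bound] has the constant 1 where 15 is allowed. *)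
  rewrite lee_fin mulrC; apply: ler_wpM2r; first exact: powR_ge0.
  by rewrite ler_pdivlMr// mulVf ?gt_eqF//; lra.
Qed.
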